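(* Let $k$ be a field, $Q=k[X]$ a polynomial ring in finitely many variables, $H\subseteq J\unlhd Q$ prime ideals, $A=Q/H$, $L=J\cdot A$, and let $\mathfrak a=L\cdot A_L$ be the maximal ideal of the localization $A_L$. Let $I\unlhd A_L$ be an ideal. For any graded $\mathrm{Gr}_{\mathfrak a}(A_L)$-free resolution $$\mathscr C_\bullet:\quad 0\longleftarrow \mathrm{Gr}_{\mathfrak a}(A_L)/\mathrm{in}_{\mathfrak a}(I)\longleftarrow \mathrm{Gr}_{\mathfrak a}(A_L)\longleftarrow N_1\longleftarrow N_2\longleftarrow\cdots$$ of $\mathrm{in}_{\mathfrak a}(I)$, with all $N_i$ of finite rank, there exists an $A_L$-free resolution, compatible with the filtrations, $$\mathscr D_\bullet:\quad 0\longleftarrow A_L/I\longleftarrow A_L\longleftarrow M_1\longleftarrow M_2\longleftarrow\cdots$$ of $I$ such that the diagram with top row $\mathscr D_\bullet$, bottom row $\mathscr C_\bullet$ and vertical maps given by taking initial forms $\mathrm{in}_{\mathfrak a}$ commutes (in the sense explained in the context), where if $N_i=\bigoplus_{j\in\mathbb Z}\mathrm{Gr}_{\mathfrak a}(A_L)(-j)^{b_{j-i,i}}$, then $M_i=\bigoplus_{j\in\mathbb Z}A_L(-j)^{b_{j-i,i}}$. In particular, if $A_L$ is regular, there always exists a finite $A_L$-free resolution of $I$.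
   Context: $\mathrm{Gr}_{\mathfrak a}(A_L)=\bigoplus_{n\ge0}\mathfrak a^n/\mathfrak a^{n+1}$. For $0\neq c\in A_L$, $\nu_{\mathfrak a}(c)$ is the unique $n\in\mathbb N$ with $c\in\mathfrak a^n\setminus\mathfrak a^{n+1}$ and $\mathrm{in}_{\mathfrak a}(c)$ is the class of $c$ in $\mathfrak a^n/\mathfrak a^{n+1}\subseteq\mathrm{Gr}_{\mathfrak a}(A_L)$; for an ideal $I\unlhd A_L$, $\mathrm{in}_{\mathfrak a}(I)=\langle\mathrm{in}_{\mathfrak a}(c)\mid 0\ne c\in I\rangle$. A resolution ''of $I$'' means a free resolution of $A_L/I$ as displayed, and likewise a resolution ''of $\mathrm{in}_{\mathfrak a}(I)$'' means a graded free resolution of $\mathrm{Gr}_{\mathfrak a}(A_L)/\mathrm{in}_{\mathfrak a}(I)$; the maps of a graded resolution are homogeneous of degree $0$. All free modules in resolutions are assumed to be of finite rank. A finite free resolution is one of finite length. Shifts and filtrations: $A_L(-d)$ is the free module of rank one with basis element $e$, filtered so that $e$ has order $d$. Thus $M=\bigoplus_{i=1}^r A_L(-d_i)$ carries the filtration $F_nM=\bigoplus_i\mathfrak a^{n-d_i}e_i$ (with $\mathfrak a^m=A_L$ for $m\le0$), and for $0\ne g\in M$, $\mathrm{ord}(g)$ is the largest $n$ with $g\in F_nM$. Its associated graded module is the graded free module $\mathrm{Gr}_{\mathfrak a}(M)=\bigoplus_i\mathrm{Gr}_{\mathfrak a}(A_L)(-d_i)$, where the basis element $e_i$ has degree $d_i$,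 so its degree-$n$ part is $\bigoplus_i\mathfrak a^{n-d_i}/\mathfrak a^{n-d_i+1}$, the summands with $n<d_i$ being zero. For $0\neq g=\sum_i g_ie_i\in M$ with $\mathrm{ord}(g)=n$, the initial form is $\mathrm{in}_{\mathfrak a}(g)=\sum_i\overline{g_i}e_i\in\mathrm{Gr}_{\mathfrak a}(M)_n$, with $\overline{g_i}$ the class of $g_i$ in $\mathfrak a^{n-d_i}/\mathfrak a^{n-d_i+1}$ (zero when $n<d_i$ or $\mathrm{ord}(g_ie_i)>n$); $\mathrm{in}_{\mathfrak a}(0)=0$. ''Compatible with the filtrations'' means that each map $M_{i+1}\to M_i$ (with $M_0=A_L$) sends $F_nM_{i+1}$ into $F_nM_i$ for all $n$. Commutativity of the diagram means: $N_i=\mathrm{Gr}_{\mathfrak a}(M_i)$ with corresponding canonical bases, and for every $i\ge0$ (with $M_0=A_L$, $N_0=\mathrm{Gr}_{\mathfrak a}(A_L)$) and every canonical basis element $e$ of $M_{i+1}$, with image $g\in M_i$, the corresponding canonical basis element of $N_{i+1}$ is mapped by the differential of $\mathscr C_\bullet$ to $\mathrm{in}_{\mathfrak a}(g)\in N_i$. *)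

(* Defs.v *)
From HB Require Import structures.
From mathcomp Require Import all_boot all_order all_algebra.
From mathcomp Require Import ring_quotient generic_quotient.
From mathcomp Require Import mathcomp_extra boolp classical_sets.
From mathcomp Require Import ring.

Set Implicit Arguments.
Unset Strict Implicit.
Unset Printing Implicit Defensive.

Import Order.TTheory GRing.Theory Num.Theory.
Local Open Scope ring_scope.
Local Open Scope quotient_scope.
Local Open Scope classical_set_scope.

(* The structure [idealr] of the library only covers proper ideals, whereas
   the unit ideal is allowed here. *)
Definition is_ideal (R : comNzRingType) (I : set R) : Prop :=
  [/\ I 0,
      forall x y, I x -> I y -> I (x + y) &
      forall a x, I x -> I (a * x)].

Definition ideal_gen (R : comNzRingType) (S : set R) : set R :=
  smallest (@is_ideal R) S.

Fixpoint ideal_exp (R : comNzRingType) (I : set R) (n : nat) : set R :=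
  if n is m.+1 then
    ideal_gen [set x * y | x in I & y in ideal_exp I m]
  else setT.

Definition ideal_extension (R S : comNzRingType) (f : R -> S) (I : {pred R}) :
  {pred S} := fun y => `[< ideal_gen (f @` [set` I]) y >].

Section IdealFacts.
Variable R : comNzRingType.
Implicit Types (I S : set R) (n : nat).

Lemma ideal_gen_ideal S : is_ideal (ideal_gen S).
Proof.
split=> [J [[]] //|x y Sx Sy J|a x Sx J] JS; have [[J0 JD JM] _] := JS.
  by apply: JD; [exact: Sx | exact: Sy].
by apply: JM; exact: Sx.
Qed.

Lemma sub_ideal_gen S : S `<=` ideal_gen S.
Proof. by move=> x Sx J [_]; apply. Qed.

Lemma ideal_gen_sub S I : is_ideal I -> S `<=` I -> ideal_gen S `<=` I.
Proof. by move=> idI SI x; apply. Qed.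

Lemma ideal_exp_ideal I n : is_ideal (ideal_exp I n).
Proof. by case: n => [|n]; [split | exact: ideal_gen_ideal]. Qed.

Lemma ideal_opp I x : is_ideal I -> I x -> I (- x).
Proof. by case=> _ _ IM Ix; rewrite -mulN1r; exact: IM. Qed.

Lemma ideal_sum I (T : Type) (r : seq T) (P : pred T) (F : T -> R) :
  is_ideal I -> (forall i, P i -> I (F i)) -> I (\sum_(i <- r | P i) F i).
Proof. by move=> [I0 ID _] IF; apply: (big_ind I). Qed.

Lemma ideal_expS I n : is_ideal I -> ideal_exp I n.+1 `<=` ideal_exp I n.
Proof.
move=> idI; apply: ideal_gen_sub; first exact: ideal_exp_ideal.
by move=> _ [x _ [y Iy <-]]; have [_ _] := ideal_exp_ideal I n; apply.
Qed.

Lemma ideal_expM I n m x y : is_ideal I ->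
  ideal_exp I n x -> ideal_exp I m y -> ideal_exp I (n + m) (x * y).
Proof.
move=> idI + Imy; elim: n x => [|n IHn] x.
  by move=> _; have [_ _] := ideal_exp_ideal I m; apply.
have [E0 ED EM] := ideal_exp_ideal I (n.+1 + m).
apply: (@ideal_gen_sub _ [set z | ideal_exp I (n.+1 + m) (z * y)]).
  split=> /= [|u v uE vE|a u uE]; first by rewrite mul0r.
    by rewrite mulrDl; exact: ED.
  by rewrite -mulrA; exact: EM.
move=> _ [u Iu [v Iv <-]] /=; rewrite -mulrA; apply: sub_ideal_gen.
by exists u => //; exists (v * y) => //; exact: IHn.
Qed.

Lemma idealr_is_ideal (I : idealr R) : is_ideal [set` I].
Proof.
split=> /= [|x y|a x]; first exact: rpred0.
  exact: rpredD.
exact: idealMr.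
Qed.

End IdealFacts.

Section QuotientPrime.
Variables (R : comNzRingType) (H J : prime_idealr R) (HJ : {subset H <= J}).

Definition quot_ideal of {subset H <= J} : {pred {ideal_quot H}} :=
  ideal_extension (\pi_{ideal_quot H}) J.

Let A : comNzRingType := {ideal_quot H}.
Let piA : R -> A := \pi_{ideal_quot H}.

Let piA0 : piA 0 = 0. Proof. exact: (rmorph0 (\pi_{ideal_quot H})). Qed.
Let piA1 : piA 1 = 1. Proof. exact: (rmorph1 (\pi_{ideal_quot H})). Qed.
Let piAD x y : piA (x + y) = piA x + piA y.
Proof. exact: (rmorphD (\pi_{ideal_quot H})). Qed.
Let piAM x y : piA (x * y) = piA x * piA y.
Proof. exact: (rmorphM (\pi_{ideal_quot H})). Qed.

Lemma quot_idealE x : (\pi_{ideal_quot H} x \in quot_ideal HJ) = (x \in J).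
Proof.
rewrite -[\pi _]/(piA x); apply/asboolP/idP => [|Jx]; last first.
  by apply: sub_ideal_gen; exists x.
move=> /(_ [set y | forall z, y = piA z -> z \in J]); apply=> //.
have JE z t : z \in J -> piA z = piA t -> t \in J.
  move=> Jz /eqP; rewrite -[_ == _]/(\pi_{ideal_quot H} z == \pi t).
  rewrite -Quotient.idealrBE => /HJ Jzt.
  by rewrite -[t](subKr z) rpredB.
split=> [|_ [z Jz <-] t]; last exact: JE.
split=> /= [z|y1 y2|a y].
- by rewrite -piA0; apply: JE; rewrite rpred0.
- elim/quotW: y1 => y1; elim/quotW: y2 => y2 Jy1 Jy2 z.
  rewrite -[\pi y1]/(piA y1) -[\pi y2]/(piA y2) -piAD; apply: JE.
  by rewrite rpredD //; [exact: Jy1 | exact: Jy2].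
- elim/quotW: a => a; elim/quotW: y => y Jy z.
  rewrite -[\pi a]/(piA a) -[\pi y]/(piA y) -piAM; apply: JE.
  by rewrite idealMr //; exact: Jy.
Qed.

Lemma quot_ideal_idealr : idealr_closed (quot_ideal HJ).
Proof.
split.
- by rewrite -[0]piA0 quot_idealE rpred0.
- by rewrite -[1]piA1 quot_idealE idealr1.
elim/quotW=> a; elim/quotW=> u; elim/quotW=> v.
rewrite -[_ + _]/(piA a * piA u + piA v) -piAM -piAD !quot_idealE => Ju Jv.
by rewrite rpredD ?idealMr.
Qed.

HB.instance Definition _ := isIdealr.Build _ (quot_ideal HJ) quot_ideal_idealr.

Lemma quot_ideal_prime : prime_idealr_closed (quot_ideal HJ).
Proof.
elim/quotW=> u; elim/quotW=> v.
by rewrite -[_ * _]/(piA u * piA v) -piAM !quot_idealE prime_idealrM.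
Qed.

HB.instance Definition _ :=
  isPrimeIdealrClosed.Build _ (quot_ideal HJ) quot_ideal_prime.

End QuotientPrime.

Module Localization.
Section Localization.
Variables (R : comNzRingType) (P : prime_idealr R).

Local Notation denom := {s : R | s \notin P}.
Local Notation frac := (R * denom)%type.
Implicit Types (x y z : frac) (s t : denom).

Lemma one_denom : (1 : R) \notin P. Proof. by rewrite idealr1. Qed.

Lemma mul_denom s t : sval s * sval t \notin P.
Proof. by rewrite prime_idealrM negb_or (svalP s) (svalP t). Qed.

Definition one_d : denom := exist _ 1 one_denom.
Definition mul_d s t : denom := exist _ (sval s * sval t) (mul_denom s t).

Definition equiv x y : bool :=
  `[< exists2 u : R, u \notin P & u * (x.1 * sval y.2 - y.1 * sval x.2) = 0 >].

Lemma equiv_refl : reflexive equiv.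
Proof. by move=> x; apply/asboolP; exists 1; rewrite ?one_denom ?subrr ?mulr0. Qed.

Lemma equiv_sym : symmetric equiv.
Proof.
suff imp x y : equiv x y -> equiv y x by move=> x y; apply/idP/idP; exact: imp.
move=> /asboolP[u Pu uE]; apply/asboolP; exists u => //.
by rewrite -opprB mulrN uE oppr0.
Qed.

Lemma equiv_trans : transitive equiv.
Proof.
move=> y x z /asboolP[u Pu uE] /asboolP[v Pv vE]; apply/asboolP.
exists (u * v * sval y.2).
  by rewrite !prime_idealrM !negb_or Pu Pv (svalP y.2).
transitivity (v * sval z.2 * (u * (x.1 * sval y.2 - y.1 * sval x.2))
  + u * sval x.2 * (v * (y.1 * sval z.2 - z.1 * sval y.2))); first by ring.
by rewrite uE vE !mulr0 addr0.
Qed.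

Canonical equiv_equiv := EquivRel equiv equiv_refl equiv_sym equiv_trans.

Definition type := {eq_quot equiv}.

#[export]
HB.instance Definition _ : EqQuotient _ equiv type := EqQuotient.on type.
#[export]
HB.instance Definition _ := Choice.on type.

Lemma equiv_repr x : exists2 u : R, u \notin P &
  u * (x.1 * sval (repr (\pi_type x)).2 - (repr (\pi_type x)).1 * sval x.2) = 0.
Proof.
by apply/asboolP; rewrite -[`[< _ >]]/(equiv _ _) -eqmodE reprK.
Qed.

Definition addf x y : frac :=
  (x.1 * sval y.2 + y.1 * sval x.2, mul_d x.2 y.2).
Definition oppf x : frac := (- x.1, x.2).
Definition mulf x y : frac := (x.1 * y.1, mul_d x.2 y.2).

Definition zero : type := lift_cst type (0, one_d).
Definition one : type := lift_cst type (1, one_d).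
Definition add := lift_op2 type addf.
Definition opp := lift_op1 type oppf.
Definition mul := lift_op2 type mulf.

Canonical pi_zero_morph := PiConst zero.
Canonical pi_one_morph := PiConst one.

Lemma pi_add : {morph \pi : x y / addf x y >-> add x y}.
Proof.
move=> x y; unlock add; apply/eqmodP/asboolP => /=.
have [u Pu uE] := equiv_repr x; have [v Pv vE] := equiv_repr y.
exists (u * v); first by rewrite prime_idealrM negb_or Pu.
move: uE vE; set x' := repr _; set y' := repr _ => uE vE.
transitivity
  (v * sval y.2 * sval y'.2 * (u * (x.1 * sval x'.2 - x'.1 * sval x.2))
  + u * sval x.2 * sval x'.2 * (v * (y.1 * sval y'.2 - y'.1 * sval y.2))).
  by ring.
by rewrite uE vE !mulr0 addr0.
Qed.
Canonical pi_add_morph := PiMorph2 pi_add.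

Lemma pi_opp : {morph \pi : x / oppf x >-> opp x}.
Proof.
move=> x; unlock opp; apply/eqmodP/asboolP => /=.
have [u Pu uE] := equiv_repr x; exists u => //.
by rewrite !mulNr -opprD mulrN uE oppr0.
Qed.
Canonical pi_opp_morph := PiMorph1 pi_opp.

Lemma pi_mul : {morph \pi : x y / mulf x y >-> mul x y}.
Proof.
move=> x y; unlock mul; apply/eqmodP/asboolP => /=.
have [u Pu uE] := equiv_repr x; have [v Pv vE] := equiv_repr y.
exists (u * v); first by rewrite prime_idealrM negb_or Pu.
move: uE vE; set x' := repr _; set y' := repr _ => uE vE.
transitivity
  (v * y.1 * sval y'.2 * (u * (x.1 * sval x'.2 - x'.1 * sval x.2))
  + u * x'.1 * sval x.2 * (v * (y.1 * sval y'.2 - y'.1 * sval y.2))).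
  by ring.
by rewrite uE vE !mulr0 addr0.
Qed.
Canonical pi_mul_morph := PiMorph2 pi_mul.

Lemma pi_eq x y : x.1 * sval y.2 = y.1 * sval x.2 -> \pi_type x = \pi_type y.
Proof.
move=> xy; apply/eqmodP/asboolP.
by exists 1; rewrite ?one_denom // xy subrr mulr0.
Qed.

Lemma addA : associative add.
Proof.
elim/quotW=> x; elim/quotW=> y; elim/quotW=> z; rewrite !piE.
by apply: pi_eq => /=; ring.
Qed.

Lemma addC : commutative add.
Proof.
elim/quotW=> x; elim/quotW=> y; rewrite !piE.
by apply: pi_eq => /=; ring.
Qed.

Lemma add0 : left_id zero add.
Proof. by elim/quotW=> x; rewrite !piE; apply: pi_eq => /=; ring. Qed.

Lemma addN : left_inverse zero opp add.
Proof. by elim/quotW=> x; rewrite !piE; apply: pi_eq => /=; ring. Qed.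

#[export]
HB.instance Definition _ := GRing.isZmodule.Build type addA addC add0 addN.

Lemma mulA : associative mul.
Proof.
elim/quotW=> x; elim/quotW=> y; elim/quotW=> z; rewrite !piE.
by apply: pi_eq => /=; ring.
Qed.

Lemma mulC : commutative mul.
Proof.
elim/quotW=> x; elim/quotW=> y; rewrite !piE.
by apply: pi_eq => /=; ring.
Qed.

Lemma mul1 : left_id one mul.
Proof. by elim/quotW=> x; rewrite !piE; apply: pi_eq => /=; ring. Qed.

Lemma mulDl : left_distributive mul add.
Proof.
elim/quotW=> x; elim/quotW=> y; elim/quotW=> z; rewrite !piE.
by apply: pi_eq => /=; ring.
Qed.

Lemma nonzero1 : one != zero.
Proof.
rewrite !piE; apply/asboolP => -[u Pu] /=.
by rewrite !mulr1 subr0 mulr1 => u0; rewrite u0 rpred0 in Pu.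
Qed.

#[export]
HB.instance Definition _ :=
  GRing.Zmodule_isComNzRing.Build type mulA mulC mul1 mulDl nonzero1.

Definition of_base (r : R) : type := \pi_type (r, one_d).

Lemma of_base_is_zmod_morphism : zmod_morphism of_base.
Proof.
move=> r r'; rewrite /of_base -[X in _ = _ + X]pi_opp -[RHS]pi_add.
by apply: pi_eq => /=; ring.
Qed.

Lemma of_base_is_monoid_morphism : monoid_morphism of_base.
Proof.
split=> [|r r']; rewrite /of_base; first by rewrite -[RHS]/one !piE.
by rewrite -[RHS]pi_mul; apply: pi_eq => /=; ring.
Qed.

#[export]
HB.instance Definition _ :=
  GRing.isZmodMorphism.Build R type of_base of_base_is_zmod_morphism.
#[export]
HB.instance Definition _ :=
  GRing.isMonoidMorphism.Build R type of_base of_base_is_monoid_morphism.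

Definition max_ideal : {pred type} := ideal_extension of_base P.

Lemma max_idealE x : (\pi_type x \in max_ideal) = (x.1 \in P).
Proof.
apply/asboolP/idP => [|Px]; last first.
  have -> : \pi_type x = \pi_type (1, x.2) * of_base x.1 :> type.
    rewrite /of_base -[RHS]pi_mul; apply: pi_eq => /=; ring.
  have [_ _] := ideal_gen_ideal (of_base @` [set` P]); apply.
  by apply: sub_ideal_gen; exists x.1.
move=> /(_ [set y | forall z, y = \pi_type z -> z.1 \in P]); apply=> //.
have PE z y : z.1 \in P -> \pi_type z = \pi_type y :> type -> y.1 \in P.
  move=> Pz /eqmodP/asboolP[u Pu].
  rewrite mulrBr => /eqP; rewrite subr_eq0 => /eqP uE.
  have : u * (y.1 * sval z.2) \in P.
    by rewrite -uE idealMr // mulrC idealMr.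
  by rewrite !prime_idealrM (negPf Pu) (negPf (svalP z.2)) orbF.
split=> [|_ [z Pz <-] y]; last exact: PE.
split=> /= [z|y1 y2|a y].
- by move=> zE; apply: (PE (0, one_d)); rewrite ?rpred0 // -zE !piE.
- elim/quotW: y1 => y1; elim/quotW: y2 => y2 Py1 Py2 z.
  rewrite -[_ + _]pi_add => zE; apply: PE zE => /=.
  by rewrite rpredD // mulrC idealMr //; [exact: Py1 | exact: Py2].
- elim/quotW: a => a; elim/quotW: y => y Py z.
  by rewrite -[_ * _]pi_mul => zE; apply: PE zE => /=; rewrite idealMr //; exact: Py.
Qed.

Lemma max_ideal_idealr : idealr_closed max_ideal.
Proof.
split.
- by have [+ _ _] := ideal_gen_ideal (of_base @` [set` P]) => /asboolP.
- by rewrite -(rmorph1 of_base) max_idealE idealr1.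
move=> a u v /asboolP Iu /asboolP Iv; apply/asboolP.
have [_ ID IM] := ideal_gen_ideal (of_base @` [set` P]).
by apply: ID => //; exact: IM.
Qed.

#[export]
HB.instance Definition _ := isIdealr.Build _ max_ideal max_ideal_idealr.

End Localization.
Module Exports. HB.reexport. End Exports.
End Localization.
Export Localization.Exports.

Notation localization P := (Localization.type P).
Notation loc_max_ideal P := (@Localization.max_ideal _ P).

(* Gr_a(R) is the quotient of the Rees algebra {p : R[t] | p_i \in a^i for all
   i} by its ideal {p | p_i \in a^(i+1) for all i}; since addition is
   coefficientwise and multiplication is convolution, this is the direct sum
   of the a^i / a^(i+1) with its usual product. *)
Section AssociatedGraded.
Variables (R : comNzRingType) (a : idealr R).
Local Notation "a ^^ n" := (ideal_exp [set` a] n) (at level 30).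

Definition in_rees : {pred {poly R}} := fun p => `[< forall i, (a ^^ i) p`_i >].

Lemma in_rees_subring : subring_closed in_rees.
Proof.
have idE := ideal_exp_ideal [set` a].
split=> [|p q /asboolP pa /asboolP qa|p q /asboolP pa /asboolP qa].
- by apply/asboolP => -[|i]; rewrite coef1 //=; have [] := idE i.+1.
- apply/asboolP => i; rewrite coefB; have [_ ED _] := idE i.
  by apply: ED => //; exact: ideal_opp.
- apply/asboolP => i; rewrite coefM; apply: ideal_sum => // j _.
  rewrite -[X in (a ^^ X) _](subnKC (leq_ord j)).
  by apply: ideal_expM => //; exact: idealr_is_ideal.
Qed.

HB.instance Definition _ :=
  GRing.isSubringClosed.Build {poly R} in_rees in_rees_subring.

Record rees := Rees { rees_poly :> {poly R}; _ : rees_poly \in in_rees }.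

HB.instance Definition _ := [isSub for rees_poly].
HB.instance Definition _ := [Choice of rees by <:].
HB.instance Definition _ := [SubChoice_isSubComNzRing of rees by <:].

Lemma reesP (p : rees) i : (a ^^ i) (p : {poly R})`_i.
Proof. by case: p => p /= /asboolP. Qed.

Definition rees_shift : {pred rees} :=
  fun p => `[< forall i, (a ^^ i.+1) (p : {poly R})`_i >].

Lemma rees_shift_idealr : idealr_closed rees_shift.
Proof.
have idE := ideal_exp_ideal [set` a].
split=> [||p u v /asboolP ua /asboolP va].
- by apply/asboolP => i; rewrite coef0; have [] := idE i.+1.
- apply/asboolP => /(_ 0%N); rewrite coef1 /= => h.
  have /= : [set` a] 1 by apply: (ideal_gen_sub _ _ h);
    [exact: idealr_is_ideal|move=> _ [x ax [y _ <-]] /=; rewrite mulrC; exact: idealMr].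
  by rewrite idealr1.
- apply/asboolP => i; rewrite coefD; have [_ ED _] := idE i.+1.
  apply: ED => //; rewrite coefM; apply: ideal_sum => // j _.
  rewrite -[X in (a ^^ X.+1) _](subnKC (leq_ord j)) -addnS.
  by apply: ideal_expM => //; [exact: idealr_is_ideal | exact: reesP].
Qed.

HB.instance Definition _ := isIdealr.Build rees rees_shift rees_shift_idealr.

Definition assoc_graded := {ideal_quot rees_shift}.
HB.instance Definition _ := GRing.ComNzRing.on assoc_graded.

(* The class of x in a^n / a^(n+1), for x in a^n (and 0 otherwise). *)
Definition gr_class (n : nat) (x : R) : assoc_graded :=
  \pi_assoc_graded (insubd (0 : rees) (x *: 'X^n)).

Lemma in_rees_monomial n x : (a ^^ n) x -> x *: 'X^n \in in_rees.
Proof.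
move=> ax; apply/asboolP => i; rewrite coefZ coefXn.
have [-> | _] := eqVneq i n; first by rewrite mulr1.
by rewrite mulr0; have [] := ideal_exp_ideal [set` a] i.
Qed.

Lemma gr_classE n x (ax : (a ^^ n) x) :
  gr_class n x = \pi_assoc_graded (Rees (in_rees_monomial ax)).
Proof.
rewrite /gr_class; congr (\pi); apply: val_inj.
by rewrite insubdK // in_rees_monomial.
Qed.

Lemma gr_class_eq0 n x : (a ^^ n) x -> gr_class n x = 0 <-> (a ^^ n.+1) x.
Proof.
move=> ax; rewrite gr_classE -[0](rmorph0 (\pi_{ideal_quot rees_shift})).
rewrite (rwP eqP) -[_ == _]/(_ == _ %[mod {ideal_quot rees_shift}]).
rewrite -Quotient.idealrBE subr0; split=> [/asboolP /(_ n)|ax'].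
  by rewrite /= coefZ coefXn eqxx mulr1.
apply/asboolP => i /=; rewrite coefZ coefXn.
have [-> | _] := eqVneq i n; first by rewrite mulr1.
by rewrite mulr0; have [] := ideal_exp_ideal [set` a] i.+1.
Qed.

Lemma gr_classD n x y : (a ^^ n) x -> (a ^^ n) y ->
  gr_class n (x + y) = gr_class n x + gr_class n y.
Proof.
move=> ax ay; have [_ ED _] := ideal_exp_ideal [set` a] n.
rewrite (gr_classE ax) (gr_classE ay) (gr_classE (ED _ _ ax ay)).
rewrite -(rmorphD (\pi_{ideal_quot rees_shift})); congr (\pi).
by apply: val_inj; rewrite /= scalerDl.
Qed.

Lemma gr_classM n m x y : (a ^^ n) x -> (a ^^ m) y ->
  gr_class (n + m) (x * y) = gr_class n x * gr_class m y.
Proof.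
move=> ax ay; have axy := ideal_expM (idealr_is_ideal a) ax ay.
rewrite (gr_classE ax) (gr_classE ay) (gr_classE axy).
rewrite -(rmorphM (\pi_{ideal_quot rees_shift})); congr (\pi).
by apply: val_inj; rewrite /= -scalerAl -scalerAr scalerA exprD.
Qed.

(* The ideal in_a(I), generated by the initial forms of the nonzero elements
   of I. *)
Definition init_ideal (I : set R) : set assoc_graded :=
  ideal_gen [set h | exists c n, [/\ I c, c <> 0, (a ^^ n) c, ~ (a ^^ n.+1) c
                                   & h = gr_class n c]].

(* Extensions to degrees in Z: a^m = R and a^m / a^(m+1) = 0 for m < 0. *)
Definition ideal_expz (m : int) : set R := if m is Posz n then a ^^ n else setT.

Definition gr_classz (m : int) (x : R) : assoc_graded :=
  if m is Posz n then gr_class n x else 0.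

Definition gr_piece (m : int) : set assoc_graded :=
  [set gr_classz m x | x in ideal_expz m].

(* A list d = [:: d_1; ...; d_r] of shifts encodes the free module
   \bigoplus_i R(-d_i), with carrier 'rV[R]_(size d), as well as
   \bigoplus_i Gr_a(R)(-d_i), with carrier 'rV[assoc_graded]_(size d). *)
Implicit Type d : seq int.

Definition filtration d (n : int) : set 'rV[R]_(size d) :=
  [set g : 'rV[R]_(size d) |
    forall j : 'I_(size d), ideal_expz (n - d`_j) (g 0 j)].

Definition graded_part d (n : int) : set 'rV[assoc_graded]_(size d) :=
  [set h : 'rV[assoc_graded]_(size d) |
    forall j : 'I_(size d), gr_piece (n - d`_j) (h 0 j)].

Definition has_order d (g : 'rV[R]_(size d)) (n : int) : Prop :=
  filtration n g /\ forall m, filtration m g -> m <= n.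

(* [is_init_form g h] means h = in_a(g); it is a relation since the order of a
   nonzero g is only known to exist when the powers of a intersect in 0. *)
Definition is_init_form d (g : 'rV[R]_(size d))
    (h : 'rV[assoc_graded]_(size d)) : Prop :=
  (g = 0 /\ h = 0) \/
  (g <> 0 /\ exists2 n, has_order g n &
     h = \row_j gr_classz (n - d`_j) (g 0 j)).

End AssociatedGraded.

Arguments gr_class {R} a n x.
Arguments gr_classz {R} a m x.
Arguments gr_piece {R} a m.
Arguments init_ideal {R} a I.
Arguments filtration {R} a {d} n.
Arguments graded_part {R} a {d} n.
Arguments has_order {R} a {d} g n.
Arguments is_init_form {R} a {d} g h.

(* Matrices act on row vectors from the right, so the rows of [D i] are the
   images in M_i of the canonical basis elements of M_(i+1). The rank r i is
   that of M_i, with M_0 = R; exactness at R of R / I <- R <- M_1 says that the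
   image of D 0 is I. Resolutions of finite length are those with r i = 0 for
   large i. *)
Definition is_free_resolution (R : comNzRingType) (I : set R) (r : nat -> nat)
    (D : forall i, 'M[R]_(r i.+1, r i)) : Prop :=
  [/\ r 0%N = 1%N,
      forall x, I x <-> exists v : 'rV_(r 1%N), v *m D 0%N = const_mx x &
      forall i (v : 'rV_(r i.+1)),
        v *m D i = 0 <-> exists w : 'rV_(r i.+2), v = w *m D i.+1].

Arguments is_free_resolution {R} I r D.

Section Resolutions.
Variables (R : comNzRingType) (a : idealr R).

(* [s i] lists the shifts of the i-th module. *)
Definition is_graded_resolution (I : set (assoc_graded a)) (s : nat -> seq int)
    (C : forall i, 'M[assoc_graded a]_(size (s i.+1), size (s i))) : Prop :=
  [/\ s 0%N = [:: 0],
      is_free_resolution I (fun i => size (s i)) C &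
      forall i n v, graded_part a n v -> graded_part a n (v *m C i)].

Definition is_filtered_resolution (I : set R) (s : nat -> seq int)
    (D : forall i, 'M[R]_(size (s i.+1), size (s i))) : Prop :=
  [/\ s 0%N = [:: 0],
      is_free_resolution I (fun i => size (s i)) D &
      forall i n v, filtration a n v -> filtration a n (v *m D i)].

End Resolutions.

Arguments is_graded_resolution {R} a I s C.
Arguments is_filtered_resolution {R} a I s D.

Definition has_prime_chain (R : comNzRingType) (d : nat) : Prop :=
  exists P : 'I_d.+1 -> prime_idealr R,
    forall i j : 'I_d.+1, (i < j)%N ->
      {subset P i <= P j} /\ ~ {subset P j <= P i}.

Definition has_krull_dim (R : comNzRingType) (d : nat) : Prop :=
  has_prime_chain R d /\ forall e, has_prime_chain R e -> (e <= d)%N.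

Definition generated_by (R : comNzRingType) (I : set R) (e : nat) : Prop :=
  exists x : 'I_e -> R, I = ideal_gen (range x).

Definition min_generators (R : comNzRingType) (I : set R) (e : nat) : Prop :=
  generated_by I e /\ forall f, generated_by I f -> (e <= f)%N.

(* For a Noetherian local ring R with maximal ideal m. *)
Definition is_regular_local (R : comNzRingType) (m : idealr R) : Prop :=
  exists2 d, has_krull_dim R d & min_generators [set` m] d.

(* Main.v *)
Require Import Defs.
From HB Require Import structures.
From mathcomp Require Import all_boot all_order all_algebra ring_quotient.
From mathcomp Require Import generic_quotient boolp classical_sets ring zify mpoly.

(** Write R for the local ring A_L, with maximal ideal a. The only facts about
    A_L that matter are that R is Noetherian (Hilbert basis theorem, quotient,
    localization) and local.

    Lifting. Free modules with shifts carry the filtration F_n, and a row of a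
    matrix over Gr_a(R) that is homogeneous of degree d lifts to a row in F_d
    with that initial form. The resolution is lifted one matrix at a time, each
    lift D_i being kept strict: an element of the image of D_i that lies in F_n
    is the image of an element of F_n. Strictness allows a homogeneous syzygy of
    C_i to be corrected, by terms of higher order, to a syzygy of D_i with the
    same initial form. Conversely the symbol of a syzygy of D_i is a syzygy of
    C_i, hence a combination of rows of C_{i+1}, so every syzygy is approximated
    modulo F_{n+1}, and then modulo any F_{n+k}, by combinations of the lifted
    rows. R need not be complete, so the approximation may not converge; instead
    Artin-Rees puts the error into a multiple of the syzygy module by a power of
    a, and Nakayama makes the lifted rows generators. Strictness of D_{i+1}
    follows from the same estimate. The first step is the same argument with the
    ideal I in place of the syzygies and in_a(I) in place of the kernel of C_i.
    See [artin_rees], [lift_generators] and [lift_graded_resolution].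

    Regular case. Suppose that a is generated by x_1, ..., x_d and that there is
    a chain of d + 1 primes. Then x_1, ..., x_d is a regular sequence, by
    induction on d ([chain_regular]): if x_1 avoids the bottom prime P_0 of the
    chain, the principal ideal theorem moves the chain to one of length d - 1
    through P_0 + (x_1), so x_2, ..., x_d is regular modulo P_0 + (x_1), and
    x_1 is regular modulo the prime P_0. A regular sequence modulo P_0 has
    vanishing Tor_1, so that P_0 = a P_0 and P_0 = 0 by Nakayama. Once the
    generators of a form a regular sequence, the i-th syzygy module of R / I in a
    minimal resolution has depth at least i ([regular_mod_syzygy]), and beyond
    the d-th step the same Tor vanishing and Nakayama force the syzygies to be
    zero. This direct argument yields a finite resolution without passing
    through Gr_a(R). *)

Set Implicit Arguments.
Unset Strict Implicit.
Unset Printing Implicit Defensive.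

Import Order.TTheory GRing.Theory Num.Theory.
Local Open Scope ring_scope.
Local Open Scope quotient_scope.
Local Open Scope classical_set_scope.

(** * Submodules and the Noetherian property *)

Section Submodules.
Variables (R : comNzRingType) (V : lmodType R).
Implicit Types (N B E : set V) (a : set R) (g : seq V).

(** Submodules are sets rather than a structure, in order to match the ideals
    of the statement, which may be improper. *)
Definition is_submod N : Prop :=
  [/\ N 0, forall u v, N u -> N v -> N (u + v) & forall c u, N u -> N (c *: u)].

(** The submodule generated by g for a = R; in general the product of that
    submodule by the ideal a. *)
Fixpoint span a g : set V :=
  if g is x :: g' then [set c *: x + u | c in a & u in span a g'] else [set 0].

Definition noetherian : Prop :=
  forall N, is_submod N -> exists g, forall v, N v <-> span setT g v.

Lemma submodD N u v : is_submod N -> N u -> N v -> N (u + v).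
Proof. by case=> _ + _; apply. Qed.

Lemma submodZ N c u : is_submod N -> N u -> N (c *: u).
Proof. by case=> _ _; apply. Qed.

Lemma submodN N u : is_submod N -> N u -> N (- u).
Proof. by move=> mN Nu; rewrite -scaleN1r; exact: submodZ. Qed.

Lemma submodB N u v : is_submod N -> N u -> N v -> N (u - v).
Proof. by move=> mN Nu Nv; apply: submodD => //; exact: submodN. Qed.

Lemma submod_addl N u v : is_submod N -> N u -> N (u + v) -> N v.
Proof. by move=> mN Nu Nuv; rewrite -(addKr u v) addrC; exact: submodB. Qed.

Definition submod_add N E : set V := [set u + v | u in N & v in E].

Lemma submod_addP N E : is_submod N -> is_submod E -> is_submod (submod_add N E).
Proof.
move=> [N0 ND NZ] [E0 ED EZ]; split.
- by exists 0 => //; exists 0 => //; rewrite addr0.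
- move=> _ _ [u Nu [v Ev <-]] [u' Nu' [v' Ev' <-]].
  exists (u + u'); first exact: ND.
  by exists (v + v'); [exact: ED | rewrite addrACA].
- move=> c _ [u Nu [v Ev <-]]; exists (c *: u); first exact: NZ.
  by exists (c *: v); [exact: EZ | rewrite scalerDr].
Qed.

Lemma sub_addl N E : is_submod E -> N `<=` submod_add N E.
Proof. by move=> [E0 _ _] u Nu; exists u => //; exists 0 => //; rewrite addr0. Qed.

Lemma sub_addr N E : is_submod N -> E `<=` submod_add N E.
Proof. by move=> [N0 _ _] u Nu; exists 0 => //; exists u => //; rewrite add0r. Qed.

Lemma span_submod a g : is_ideal a -> is_submod (span a g).
Proof.
move=> [a0 aD aM]; elim: g => [|x g [IH0 IHD IHZ]] /=.
  by split=> [|_ _ -> ->|c _ ->]; rewrite ?addr0 ?scaler0.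
split.
- by exists 0 => //; exists 0 => //; rewrite scale0r addr0.
- move=> _ _ [c ac [u su <-]] [d ad [v sv <-]].
  exists (c + d); first exact: aD.
  by exists (u + v); [exact: IHD | rewrite scalerDl addrACA].
- move=> e _ [c ac [u su <-]]; exists (e * c); first exact: aM.
  by exists (e *: u); [exact: IHZ | rewrite scalerDr scalerA].
Qed.

Lemma idealT : is_ideal (setT : set R). Proof. by split. Qed.

Lemma spanT_submod g : is_submod (span setT g).
Proof. exact/span_submod/idealT. Qed.

Lemma span_mem a g c x : is_ideal a -> a c -> x \in g -> span a g (c *: x).
Proof.
move=> aI ac; have [a0 aD aM] := aI; elim: g => //= y g IH.
rewrite inE => /predU1P[->|/IH sx]; last first.
  by exists 0 => //; exists (c *: x) => //; rewrite scale0r add0r.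
exists c => //; exists 0; last by rewrite addr0.
by have [] := span_submod g aI.
Qed.

Lemma spanT_mem g x : x \in g -> span setT g x.
Proof. by move=> xg; rewrite -(scale1r x); apply: span_mem => //; exact: idealT. Qed.

Lemma span_sub a g N : is_submod N -> (forall c x, a c -> x \in g -> N (c *: x)) ->
  span a g `<=` N.
Proof.
move=> mN; elim: g => [|x g IH] gN /=; first by move=> _ ->; case: mN.
move=> _ [c ac [u su <-]]; apply: submodD => //; first by apply: gN; rewrite ?mem_head.
by apply: IH su => c' y ac' yg; apply: gN => //; rewrite inE yg orbT.
Qed.

Lemma spanT_sub g N : is_submod N -> (forall x, x \in g -> N x) -> span setT g `<=` N.
Proof. by move=> mN gN; apply: span_sub => // c x _ /gN; exact: submodZ. Qed.

Lemma span_cat a g h v : is_ideal a ->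
  span a (g ++ h) v <-> exists2 u, span a g u & span a h (v - u).
Proof.
move=> aI; split; last first.
  move=> [u gu hu]; rewrite -(subrK u v).
  have mS := span_submod (g ++ h) aI.
  apply: submodD => //; first apply: (span_sub mS) hu; last apply: (span_sub mS) gu;
    by move=> c x ac xg; apply: span_mem => //; rewrite mem_cat xg ?orbT.
elim: g v => [|x g IH] v /=; first by exists 0 => //; rewrite subr0.
move=> [c ac [u /IH[w gw hw] <-]]; exists (c *: x + w); first by exists c => //; exists w.
by rewrite opprD addrACA subrr add0r.
Qed.

Lemma span_mull a g c v :
  is_ideal a -> a c -> span setT g v -> span a g (c *: v).
Proof.
move=> aI ac; have [_ _ aM] := aI; elim: g v => [|y g IH] v /=.
  by move=> ->; rewrite scaler0.
move=> [d _ [u /IH gu <-]]; exists (c * d); first by rewrite mulrC; exact: aM.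
by exists (c *: u); rewrite // scalerDr scalerA.
Qed.

(** Otherwise dependent choice yields a strictly increasing sequence of members
    of the family; its union is finitely generated, so it is reached at a finite
    stage. *)
Lemma noetherian_max (F : set (set V)) : noetherian ->
  (forall N, F N -> is_submod N) -> F !=set0 ->
  exists2 N, F N & forall N', F N' -> N `<=` N' -> N' `<=` N.
Proof.
move=> noe FS [N0 FN0]; apply: contrapT => nomax.
pose T := {N | F N}.
have next (N : T) : exists N' : T, sval N `<=` sval N' /\ ~ sval N' `<=` sval N.
  apply: contrapT => no; apply: nomax; exists (sval N); first exact: (svalP N).
  move=> N' FN' NN'; apply: contrapT => N'N; apply: no.
  by exists (exist _ N' FN').
pose s n : T := iter n (fun N : T => projT1 (cid (next N))) (exist _ N0 FN0).
have sS n : sval (s n) `<=` sval (s n.+1) /\ ~ sval (s n.+1) `<=` sval (s n).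
  by rewrite /= ; case: (cid _).
have sle n m : (n <= m)%N -> sval (s n) `<=` sval (s m).
  by elim: m => [|m IH]; [rewrite leqn0 => /eqP -> |
     rewrite leq_eqVlt => /predU1P[->//|/IH h] x /h; apply: (sS m).1].
pose U : set V := [set v | exists n, sval (s n) v].
have mU : is_submod U.
  split.
  - by exists 0%N; have [] := FS _ (svalP (s 0%N)).
  - move=> u v [n nu] [m mv]; exists (maxn n m); apply: submodD.
    + exact: FS (svalP _).
    + by apply: sle nu; exact: leq_maxl.
    + by apply: sle mv; exact: leq_maxr.
  - by move=> c u [n nu]; exists n; apply: submodZ => //; exact: FS (svalP _).
have [g gU] := noe U mU.
have [n gn] : exists n, forall x, x \in g -> sval (s n) x.
  have : forall x, x \in g -> U x by move=> x /spanT_mem /gU.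
  elim: (g) => [|x h IH] hU; first by exists 0%N.
  have [|n hn] := IH; first by move=> y yh; apply: hU; rewrite inE yh orbT.
  have [|m mx] := hU x; first by rewrite mem_head.
  exists (maxn n m) => y; rewrite inE => /predU1P[->|/hn].
    by apply: sle mx; exact: leq_maxr.
  by apply: sle; exact: leq_maxl.
apply: (sS n).2 => v sv.
have /gU : U v by exists n.+1.
by apply: spanT_sub => //; exact: FS (svalP _).
Qed.

End Submodules.

Arguments noetherian {R} V.

Definition noetherian_ring (R : comNzRingType) : Prop := noetherian R^o.

Lemma submodT (R : comNzRingType) (V : lmodType R) : is_submod (@setT V).
Proof. by split. Qed.

Lemma submod0 (R : comNzRingType) (V : lmodType R) : is_submod [set (0 : V)].
Proof. by split=> [|_ _ -> ->|c _ ->]; rewrite ?addr0 ?scaler0. Qed.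

Section LinearMaps.
Variables (R : comNzRingType) (V W : lmodType R) (f : {linear V -> W}).

Lemma image_submod N : is_submod N -> is_submod (f @` N).
Proof.
move=> mN; split; first by exists 0; [case: mN | rewrite linear0].
  by move=> _ _ [u Nu <-] [v Nv <-]; exists (u + v); [exact: submodD | rewrite linearD].
by move=> c _ [u Nu <-]; exists (c *: u); [exact: submodZ | rewrite linearZ].
Qed.

Lemma preimage_submod N : is_submod N -> is_submod (f @^-1` N).
Proof.
move=> mN; split=> [|u v Nu Nv|c u Nu]; rewrite /preimage /=.
- by rewrite linear0; case: mN.
- by rewrite linearD; exact: submodD.
- by rewrite linearZ; exact: submodZ.
Qed.

End LinearMaps.

(** Generators of the image of N in W, lifted to N, together with generators of
    the preimage of N in U, generate N. *)
Lemma noetherian_ext (R : comNzRingType) (U V W : lmodType R)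
    (i : {linear U -> V}) (f : {linear V -> W}) :
  (forall v, f v = 0 -> exists u, v = i u) ->
  noetherian U -> noetherian W -> noetherian V.
Proof.
move=> ker_f noeU noeW N mN.
have [gU gUP] := noeU _ (preimage_submod i mN).
have [gW gWP] := noeW _ (image_submod f mN).
have [h hN hW] : exists2 h, (forall x, x \in h -> N x) & map f h = gW.
  have : forall w, w \in gW -> (f @` N) w by move=> w /spanT_mem /gWP.
  elim: (gW) => [|w g IH] gN; first by exists [::].
  have [|h hN <-] := IH; first by move=> y yg; apply: gN; rewrite inE yg orbT.
  have [|x Nx <-] := gN w; first by rewrite mem_head.
  by exists (x :: h) => // y; rewrite inE => /predU1P[->//|/hN].
have span_map (X Y : lmodType R) (F : {linear X -> Y}) s w :
    span setT (map F s) w -> exists2 v, span setT s v & F v = w.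
  elim: s w => [|x s IH] w /=; first by move=> ->; exists 0; rewrite ?linear0.
  move=> [c _ [u /IH[v sv <-] <-]]; exists (c *: x + v); first by exists c => //; exists v.
  by rewrite linearD linearZ.
exists (h ++ map i gU) => v; rewrite span_cat; last exact: idealT.
have hsub : span setT h `<=` N by exact: spanT_sub.
split=> [Nv|[u /hsub Nu]].
  have /gWP : (f @` N) (f v) by exists v.
  rewrite -hW => /span_map [u hu fu]; exists u => //.
  have [|t tE] := ker_f (v - u); first by rewrite linearB fu subrr.
  have /gUP : (i @^-1` N) t by rewrite /preimage /= -tE; apply: submodB => //; exact: hsub.
  rewrite tE; elim: (gU) (t) => [|y g IH] /= {tE}t; first by move=> ->; rewrite linear0.
  by move=> [c _ [w /IH gw <-]]; exists c => //; exists (i w); rewrite // linearD linearZ.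
move=> sv; rewrite -(subrK u v); apply: submodD => //.
apply: (spanT_sub mN _ sv) => x /mapP[y yg ->].
by apply/(gUP y)/spanT_mem.
Qed.

Section FirstCoordinate.
Variables (R : comNzRingType) (r : nat).

Definition first_coord (v : 'rV[R]_(1 + r)) : R^o := v 0 0.

Lemma first_coord_linear : linear first_coord.
Proof. by move=> c u v; rewrite /first_coord !mxE. Qed.

HB.instance Definition _ :=
  GRing.isLinear.Build R 'rV[R]_(1 + r) R^o *:%R first_coord first_coord_linear.

Definition pad0 (v : 'rV[R]_r) : 'rV[R]_(1 + r) := row_mx 0 v.

Lemma pad0_linear : linear pad0.
Proof. by move=> c u v; rewrite /pad0 scale_row_mx add_row_mx scaler0 addr0. Qed.

HB.instance Definition _ :=
  GRing.isLinear.Build R 'rV[R]_r 'rV[R]_(1 + r) *:%R pad0 pad0_linear.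

End FirstCoordinate.

Lemma noetherian_rV (R : comNzRingType) r : noetherian_ring R -> noetherian 'rV[R]_r.
Proof.
move=> noeR; elim: r => [|r IH].
  move=> N [N0 _ _]; exists [::] => v; split=> [_|->//]; rewrite /=.
  by apply/rowP; case.
apply: (@noetherian_ext R _ _ R^o (@pad0 R r) (@first_coord R r)) => // v v0.
exists (rsubmx v); apply/rowP => j; rewrite mxE; case: splitP => k jk.
  rewrite mxE -[RHS]v0 /first_coord; congr (v 0 _); apply: val_inj.
  by rewrite /= jk ord1.
by rewrite mxE; congr (v 0 _); apply: val_inj.
Qed.

Section RowSpaces.
Variable R : comNzRingType.

Definition row_image l r (G : 'M[R]_(l, r)) : set 'rV[R]_r := range (mulmxr G).
Definition row_kernel l r (G : 'M[R]_(l, r)) : set 'rV[R]_l := [set v | v *m G = 0].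

Lemma row_image_submod l r (G : 'M[R]_(l, r)) : is_submod (row_image G).
Proof. exact: (image_submod (mulmxr G) (@submodT R _)). Qed.

Lemma row_kernel_submod l r (G : 'M[R]_(l, r)) : is_submod (row_kernel G).
Proof. exact: (preimage_submod (mulmxr G) (@submod0 R _)). Qed.

End RowSpaces.

(** * The Hilbert basis theorem and localizations of affine rings *)

(** Common to quotients and localizations: an ideal of S is generated by the image
    of its contraction to R, since its elements are unit multiples of elements
    of that image. *)
Lemma noetherian_unit_image (R S : comNzRingType) (f : {rmorphism R -> S}) :
  (forall s, exists u v r, v * u = 1 /\ s = u * f r) ->
  noetherian_ring R -> noetherian_ring S.
Proof.
move=> fP noeR N mN.
have mfN : @is_submod R R^o (f @^-1` N).
  split=> [|x y Nx Ny|c x Nx]; rewrite /preimage /=.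
  - by rewrite rmorph0; case: mN.
  - by rewrite rmorphD; exact: (submodD mN).
  - by rewrite rmorphM; exact: (submodZ _ mN).
have [g gN] := noeR _ mfN.
exists (map f g) => s; split=> [Ns|]; last first.
  apply: (@spanT_sub S S^o _ N mN) => _ /mapP[x xg ->].
  by apply/(gN x)/spanT_mem.
have [u [v [r [vu sE]]]] := fP s.
have /gN : (f @^-1` N) r.
  by rewrite /preimage /= -[f r]mul1r -vu -mulrA -sE; exact: (submodZ v mN).
rewrite sE => gr; apply: (submodZ u (spanT_submod _)) => {sE}.
elim: g r gr {gN} => [|x g IH] r /=; first by move=> ->; exact: rmorph0.
move=> [c _ [t /IH gt <-]]; exists (f c) => //; exists (f t) => //.
by rewrite rmorphD rmorphM.
Qed.

Section HilbertBasis.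
Variable R : comNzRingType.
Hypothesis noeR : noetherian_ring R.

(** The ideals L n of leading coefficients in degree n of elements of I increase,
    so they stop at some N. Division then reduces each element of I to one of
    degree at most N, and those form a submodule of a free R-module of rank
    N + 1. *)
Theorem noetherian_poly : noetherian_ring {poly R}.
Proof.
move=> I mI.
pose L n : set R^o := [set c | exists p, [/\ I p, (size p <= n.+1)%N & p`_n = c]].
have mL n : is_submod (L n).
  split; first by exists 0; split; rewrite ?size_poly0 ?coef0 //; case: mI.
    move=> _ _ [p [Ip sp <-]] [q [Iq sq <-]]; exists (p + q); split.
    - exact: (submodD mI).
    - by apply: leq_trans (size_polyD _ _) _; rewrite geq_max sp.
    - by rewrite coefD.
  move=> c _ [p [Ip sp <-]]; exists (c%:P * p); split.
  - exact: (submodZ c%:P mI).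
  - by rewrite mul_polyC; exact: leq_trans (size_scale_leq _ _) sp.
  - by rewrite coefCM.
have LS n : L n `<=` L n.+1.
  move=> _ [p [Ip sp <-]]; exists ('X * p); split.
  - exact: (submodZ 'X mI).
  - by rewrite mulrC; apply: leq_trans (size_polyMleq _ _) _; rewrite size_polyX addn2.
  - by rewrite coefXM.
have Lle n m : (n <= m)%N -> L n `<=` L m.
  move=> nm; rewrite -(subnKC nm); elim: (m - n)%N => [|k IH]; first by rewrite addn0.
  by rewrite addnS; apply: subset_trans IH (LS _).
have [||_ [N _ <-] maxN] := @noetherian_max _ _ (range L) noeR.
- by move=> _ [n _ <-].
- by exists (L 0%N); exists 0%N.
have LN n : L n `<=` L N.
  apply: subset_trans (Lle _ _ (leq_maxl n N)) _.
  by apply: maxN; [exists (maxn n N) | apply: Lle; exact: leq_maxr].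
have mK : @is_submod R 'rV[R]_N.+1 [set v | I (rVpoly v)].
  split=> /= [|u v Iu Iv|c u Iu].
  - by rewrite linear0; case: mI.
  - by rewrite linearD; exact: (submodD mI).
  - by rewrite linearZ /= -mul_polyC; exact: (submodZ c%:P mI).
have [g gK] := noetherian_rV noeR mK.
pose h : seq {poly R}^o := map rVpoly g.
exists h => p; split; last first.
  apply: (@spanT_sub _ {poly R}^o _ I mI) => _ /mapP[v vg ->].
  by apply/(gK v)/spanT_mem.
have small q : I q -> (size q <= N.+1)%N -> span setT h q.
  move=> Iq sq; have qE := poly_rV_K sq.
  have /gK : I (rVpoly (poly_rV q : 'rV_N.+1)) by rewrite qE.
  rewrite -[X in _ -> span _ _ X]qE /h; elim: (g) (poly_rV q) => [|x s IH] v /=.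
    by move=> ->; rewrite linear0.
  move=> [c _ [w /IH sw <-]]; exists c%:P => //; exists (rVpoly w) => //.
  by rewrite linearD linearZ /= -mul_polyC.
have [n] := ubnP (size p); elim: n p => // n IH p; rewrite ltnS => sp Ip.
have [|big] := leqP (size p) N.+1; first exact: small.
have [m sE] : exists m, size p = m.+1 by case: (size p) big => // m _; exists m.
have Nm : (N < m)%N by rewrite sE ltnS in big.
have [q [Iq sq qN]] : L N p`_m by apply: (LN m); exists p; rewrite sE.
(* The size of a polynomial is its degree plus one, so p has degree m > N;
   subtracting a multiple of q cancels its leading term. *)
have Xq : I ('X^(m - N) * q) by exact: (submodZ _ mI).
have mh := spanT_submod h.
rewrite -(subrK ('X^(m - N) * q) p); apply: (submodD mh); last first.
  by apply: (submodZ 'X^(m - N) mh); exact: small.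
apply: IH; last exact: (submodB mI).
apply: leq_trans (sp); rewrite sE ltnS; apply/leq_sizeP => j.
rewrite leq_eqVlt coefB coefXnM => /predU1P[<-|mj].
  by rewrite ltnNge leq_subr /= subKn 1?ltnW // qN subrr.
have -> : p`_j = 0 by apply: nth_default; rewrite sE.
case: ifP => [_|/negbT]; rewrite ?subrr // -leqNgt => _.
by rewrite (nth_default 0) ?subrr // (leq_trans sq) //; lia.
Qed.

End HilbertBasis.

Lemma noetherian_field (k : fieldType) : noetherian_ring k.
Proof.
move=> N mN; have [[x Nx x0]|no] := pselect (exists2 x, N x & x != 0).
  exists [:: x] => v; split=> [_|[c _ [_ -> <-]]]; last first.
    by rewrite addr0; exact: (submodZ c mN).
  exists (v / x) => //; exists 0 => //.
  by rewrite addr0 -[LHS]/(v / x * x) divfK.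
exists [::] => v; split=> [Nv|->]; last by case: mN.
by apply/eqP; apply: contrapT => /negP v0; apply: no; exists v.
Qed.

(** By induction on the number of variables: polynomials in n + 1 variables are
    the image of polynomials in one variable over those in n variables. *)
Lemma noetherian_mpoly (k : fieldType) n : noetherian_ring {mpoly k[n]}.
Proof.
elim: n => [|n IH].
  pose f := [the {rmorphism k -> {mpoly k[0]}} of @mpolyC 0 k].
  apply: (noetherian_unit_image (f := f) _ (@noetherian_field k)) => p.
  exists 1, 1, p@_0%MM; split; rewrite !mul1r //; apply/mpolyP => m.
  rewrite mcoeffC; have -> : m = 0%MM by apply/mnmP; case.
  by rewrite eqxx mulr1.
pose Q : comNzRingType := {mpoly k[n]}.
have cF : commr_rmorph (@mwiden n k) ('X_ord_max : {mpoly k[n.+1]}).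
  by move=> x; exact: mulrC.
pose f := [the {rmorphism {poly Q} -> {mpoly k[n.+1]}} of horner_morph cF].
apply: (noetherian_unit_image (f := f) _ (noetherian_poly IH)) => p; rewrite {}/f /=.
exists 1, 1; suff [r ->] : exists r, p = horner_morph cF r by exists r; rewrite !mul1r.
elim/mpolyind: p => [|c m p _ _ [r ->]]; first by exists 0; rewrite rmorph0.
suff [q ->] : exists q, c *: 'X_[m] = horner_morph cF q by exists (q + r); rewrite rmorphD.
have imX i : exists q, 'X_i = horner_morph cF q.
  have [->|] := eqVneq i ord_max; first by exists 'X; rewrite horner_morphX.
  move=> im; have lt : (i < n)%N.
    by move: im (ltn_ord i); rewrite -(inj_eq val_inj) /= ltnS leq_eqVlt => /negPf ->.
  exists (('X_(Ordinal lt) : Q)%:P); rewrite horner_morphC /= mwidenX mnmwiden1.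
  by congr 'X_[U_(_)]; apply: val_inj.
have [q ->] : exists q, 'X_[m] = horner_morph cF q.
  rewrite mpolyXE_id; elim/big_ind: _ => [|_ _ [q ->] [q' ->]|i _].
  - by exists 1; rewrite rmorph1.
  - by exists (q * q'); rewrite rmorphM.
  - by have [q ->] := imX i; exists (q ^+ m i); rewrite rmorphXn.
exists ((c%:MP : Q)%:P * q); rewrite rmorphM /= horner_morphC /= mwidenC.
by rewrite mul_mpolyC.
Qed.

Lemma noetherian_quot (Q : comNzRingType) (H : idealr Q) :
  noetherian_ring Q -> noetherian_ring {ideal_quot H}.
Proof.
pose f := [the {rmorphism Q -> {ideal_quot H}} of \pi_{ideal_quot H}].
apply: (noetherian_unit_image (f := f)).
by elim/quotW => x; exists 1, 1, x; rewrite !mul1r.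
Qed.

Lemma noetherian_localization (A : comNzRingType) (P : prime_idealr A) :
  noetherian_ring A -> noetherian_ring (localization P).
Proof.
pose f := [the {rmorphism A -> localization P} of @Localization.of_base A P].
apply: (noetherian_unit_image (f := f)).
elim/quotW => -[x s].
exists (\pi_(localization P) (1, s)), (Localization.of_base P (sval s)), x.
split.
- rewrite /Localization.of_base -[LHS]Localization.pi_mul.
  rewrite -[RHS](rmorph1 (@Localization.of_base A P)).
  by apply: Localization.pi_eq => /=; ring.
- rewrite /Localization.of_base -[RHS]Localization.pi_mul.
  by apply: Localization.pi_eq => /=; ring.
Qed.

Lemma localization_unit (A : comNzRingType) (P : prime_idealr A) (x : localization P) :
  x \notin loc_max_ideal P -> exists y, y * x = 1.
Proof.
elim/quotW: x => -[x s]; rewrite Localization.max_idealE /= => Px.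
exists (\pi_(localization P) (sval s, exist _ x Px)).
rewrite -[LHS]Localization.pi_mul -[RHS](rmorph1 (@Localization.of_base A P)).
by apply: Localization.pi_eq => /=; ring.
Qed.

(** * Nakayama and Artin-Rees *)

Section Nakayama.
Variable R : comNzRingType.
Implicit Type P : set R.

Definition is_prime P : Prop :=
  [/\ is_ideal P, ~ P 1 & forall x y, P (x * y) -> P x \/ P y].

Lemma prime_notM P x y : is_prime P -> ~ P x -> ~ P y -> ~ P (x * y).
Proof. by case=> _ _ PM Px Py /PM[]. Qed.

Lemma primeX P x n : is_prime P -> P (x ^+ n) -> P x.
Proof.
move=> [_ P1 PM]; elim: n => [|n IH]; first by rewrite expr0 => /P1.
by rewrite exprS => /PM[].
Qed.

Variable V : lmodType R.
Implicit Types (B : set V) (g : seq V).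

(** The elements of V that enter B after localization at P. Saturating replaces
    localizing, so that the arguments below stay inside one ring. *)
Definition saturation P B : set V := [set v | exists2 s, ~ P s & B (s *: v)].

Lemma sub_saturation P B : is_prime P -> B `<=` saturation P B.
Proof. by move=> [_ P1 _] v Bv; exists 1; rewrite ?scale1r. Qed.

Lemma saturation_submod P B : is_prime P -> is_submod B -> is_submod (saturation P B).
Proof.
move=> pP mB; split.
- by apply: sub_saturation => //; case: mB.
- move=> u v [s Ps Bu] [t Pt Bv]; exists (s * t); first exact: prime_notM.
  rewrite scalerDr; apply: submodD => //; last by rewrite -scalerA; exact: submodZ.
  by rewrite mulrC -scalerA; exact: submodZ.
- move=> c u [s Ps Bu]; exists s => //.
  by rewrite scalerA mulrC -scalerA; exact: submodZ.
Qed.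

Lemma saturation_id P B : is_prime P -> saturation P (saturation P B) `<=` saturation P B.
Proof.
move=> pP v [s Ps [t Pt Bv]]; exists (t * s); first exact: prime_notM.
by rewrite -scalerA.
Qed.

(** Nakayama for the localization at P. The relation for the first generator x
    reads (s - c) x in B + P h with c in P and h the other generators, so s - c lies outside P and x can be
    eliminated from the relations of the other generators. *)
Theorem nakayama P B g : is_prime P -> is_submod B ->
  (forall x, x \in g -> saturation P (submod_add B (span P g)) x) ->
  forall x, x \in g -> saturation P B x.
Proof.
move=> pP mB; have [iP P1 PM] := pP; have [_ PD PZ] := iP.
elim: g => // x g IH gP.
have [|s Ps [b Bb [_ [c Pc [u gu <-]] sx]]] := gP x; first exact: mem_head.
have Pt : ~ P (s - c) by move=> Psc; apply: Ps; rewrite -(subrK c s); exact: PD.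
have tx : (s - c) *: x = b + u.
  by rewrite scalerBl -sx addrCA addrAC subrr add0r.
have gB y : y \in g -> saturation P B y.
  apply: IH => {}y yg; have [|t Pt' [b' Bb' [_ [c' Pc' [u' gu' <-]] ty]]] := gP y.
    by rewrite inE yg orbT.
  exists ((s - c) * t); first exact: prime_notM.
  have mS := span_submod g iP.
  have mBS := submod_addP mB mS.
  rewrite -scalerA -ty !scalerDr; apply: submodD => //.
    by apply: submodZ => //; exact: sub_addl.
  apply: submodD => //; last by apply: submodZ => //; exact: sub_addr.
  rewrite scalerA mulrC -scalerA tx; apply: submodZ => //.
  by exists b => //; exists u.
move=> y; rewrite inE => /predU1P[{y}->|]; last exact: gB.
apply: saturation_id => //; exists (s - c) => //; rewrite tx.
have mB' := saturation_submod pP mB.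
apply: submodD => //; first exact: sub_saturation.
by apply: (span_sub mB' _ gu) => d y _ /gB; exact: submodZ.
Qed.

Definition is_local (m : set R) : Prop :=
  [/\ is_ideal m, ~ m 1 & forall x, ~ m x -> exists y, y * x = 1].

Lemma local_prime m : is_local m -> is_prime m.
Proof.
move=> [mI m1 mU]; split=> // x y mxy; case: (pselect (m x)) => [|/mU[z zx]]; first by left.
by right; have [_ _ mM] := mI; rewrite -(mul1r y) -zx -mulrA; exact: mM.
Qed.

Lemma saturation_local m B : is_local m -> is_submod B -> saturation m B `<=` B.
Proof.
move=> [_ _ mU] mB v [s /mU[t ts]] Bsv.
by rewrite -(scale1r v) -ts -scalerA; exact: submodZ.
Qed.

Corollary nakayama_local m B N g : is_local m -> is_submod B ->
  (forall v, N v <-> span setT g v) ->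
  N `<=` submod_add B (span m g) -> N `<=` B.
Proof.
move=> lm mB gN NB v /gN; apply: (spanT_sub mB) => x xg; apply: (saturation_local lm) => //.
apply: (nakayama (local_prime lm) mB) xg => y /spanT_mem/gN/NB.
exact/sub_saturation/local_prime.
Qed.

End Nakayama.

Section ArtinRees.
Variable R : comNzRingType.
Hypothesis noeR : noetherian_ring R.

Lemma ideal_submod (I : set R) : is_ideal I -> @is_submod R R^o I.
Proof. by []. Qed.

(** Let G be the stationary value of the iterated colon ideals of e by a. If 1
    were not in G, multiplying 1 by suitable powers of the generators of a would
    give an element outside G that every generator sends into G, against
    G = (G : a). So 1 lies in the n-th colon ideal, which says that the n-th
    power of a lies in e. *)
Lemma ideal_exp_sub_of_nil (a e : set R) : is_ideal a -> is_ideal e ->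
  (forall x, a x -> exists n, e (x ^+ n)) -> exists n, ideal_exp a n `<=` e.
Proof.
move=> aI eI a_nil; have [e0 eD eM] := eI.
pose G n : set R^o := iter n (fun G => [set r | forall x, a x -> G (r * x)]) e.
have mG n : is_submod (G n).
  elim: n => [|n [IH0 IHD IHM]]; first exact: ideal_submod.
  split=> /= [x _|r s rG sG x ax|c r rG x ax].
  - by rewrite mul0r.
  - by rewrite mulrDl; apply: IHD; [exact: rG | exact: sG].
  - by rewrite -mulrA; apply: IHM; exact: rG.
have eG n : e `<=` G n.
  elim: n => // n IH r er x _; rewrite mulrC.
  exact: (submodZ x (mG n) (IH _ er)).
have [||_ [n _ <-] maxG] := @noetherian_max _ _ (range G) noeR.
- by move=> _ [n _ <-].
- by exists e; exists 0%N.
exists n; have : G n 1.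
  apply: contrapT => G1; have [g ga] := noeR (ideal_submod aI).
  have : forall x, x \in g -> exists k, e (x ^+ k) by move=> x /spanT_mem/ga/a_nil.
  suff: (forall x, x \in g -> exists k, e (x ^+ k)) ->
      exists r, ~ G n r /\ forall x, x \in g -> G n (r * x).
    move=> h /h [r [Gr rg]]; apply: Gr; apply: maxG.
    - by exists n.+1.
    - by move=> y Gy x _; rewrite mulrC; exact: (submodZ x (mG n)).
    - move=> x /ga; apply: (@spanT_sub _ R^o _ [set x | G n (r * x)]) => //.
      split=> /= [|y z Gy Gz|c y Gy].
      + by rewrite mulr0; case: (mG n).
      + by rewrite mulrDr; exact: (submodD (mG n)).
      + by rewrite -[c *: y]/(c * y) mulrCA; exact: (submodZ c (mG n)).
  elim: (g) => [|x h IH] hP; first by exists 1.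
  have [|r [Gr rh]] := IH; first by move=> y yh; apply: hP; rewrite inE yh orbT.
  have [|k ek] := hP x; first exact: mem_head.
  have exk : exists k, `[< G n (r * x ^+ k) >].
    by exists k; apply/asboolP; apply: (submodZ r (mG n)); exact: eG.
  (* The last power of x that keeps the product outside G. *)
  case: (ex_minnP exk) => [[|j] /asboolP Gj jmin].
    by case: Gr; rewrite expr0 mulr1 in Gj.
  exists (r * x ^+ j); split.
    by move=> h'; have := jmin j; rewrite ltnn => /(_ (asboolT h')).
  move=> y; rewrite inE => /predU1P[->|/rh ry]; first by rewrite -mulrA -exprSr.
  by rewrite mulrAC mulrC; exact: (submodZ _ (mG n)).
suff GP k r c : G k r -> ideal_exp a k c -> e (r * c).
  by move=> /GP h c /h; rewrite mul1r.
elim: k r c => [|k IH] r c /=; first by move=> er _; rewrite mulrC; exact: eM.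
move=> rG; apply: (@ideal_gen_sub _ _ [set c | e (r * c)]).
  split=> /= [|x y ex ey|x y ey]; first by rewrite mulr0.
    by rewrite mulrDr; exact: eD.
  by rewrite mulrCA; exact: eM.
by move=> _ [x ax [y ay <-]] /=; rewrite mulrA; apply: IH => //; exact: rG.
Qed.

(** A qualitative form: N meets a deep power of a times V inside K as soon as K
    contains a power of a times N. Take E maximal among submodules with N `&` E = K. For x in a, let k be such that the
    colon submodules of E by the powers of x are stationary from k on; then
    adding x^k V to E does not enlarge the intersection with N, so x^k V lies in
    E by maximality. *)
Theorem artin_rees (V : lmodType R) (N K : set V) (a : set R) n :
  noetherian V -> is_submod N -> is_submod K -> is_ideal a -> K `<=` N ->
  (forall c v, ideal_exp a n c -> N v -> K (c *: v)) ->
  exists E m, [/\ is_submod E, forall c v, ideal_exp a m c -> E (c *: v)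
                & N `&` E `<=` K].
Proof.
move=> noeV mN mK aI KN aNK.
pose F : set (set V) := [set E | [/\ is_submod E, K `<=` E & N `&` E `<=` K]].
have [||E [mE KE NE] maxE] := noetherian_max noeV (F := F).
- by move=> E [].
- by exists K; split=> // v [].
suff [m mP] : exists m, ideal_exp a m `<=` [set c | forall v, E (c *: v)].
  by exists E, m; split=> // c v /mP.
apply: ideal_exp_sub_of_nil => //.
  split=> [v|c d cE dE v|c d dE v] /=; first by rewrite scale0r; case: mE.
    by rewrite scalerDl; exact: submodD.
  by rewrite -scalerA; exact: submodZ.
move=> x ax; pose G k : set V := [set v | E (x ^+ k *: v)].
have GS k : G k `<=` G k.+1.
  by move=> v Gv; rewrite /G /= exprS -scalerA; exact: submodZ.
have [||_ [k _ <-] maxG] := noetherian_max noeV (F := range G).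
- move=> _ [k _ <-]; split=> [|u v Gu Gv|c u Gu]; rewrite /G /=.
  + by rewrite scaler0; case: mE.
  + by rewrite scalerDr; exact: submodD.
  + by rewrite scalerA mulrC -scalerA; exact: submodZ.
- by exists (G 0%N); exists 0%N.
have Gk j : G (k + j)%N `<=` G k.
  apply: maxG; first by exists (k + j)%N.
  by elim: j => [|j IH]; rewrite ?addn0 // addnS; exact: subset_trans (GS _).
exists k => v; pose X : set V := range (fun v => x ^+ k *: v).
have mX : is_submod X.
  split; first by exists 0; rewrite ?scaler0.
    by move=> _ _ [u _ <-] [w _ <-]; exists (u + w); rewrite ?scalerDr.
  by move=> c _ [u _ <-]; exists (c *: u); rewrite // !scalerA mulrC.
suff FX : F (submod_add X E).
  by apply: (maxE _ FX); [exact: sub_addr | apply: sub_addl => //; exists v].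
split; first exact: submod_addP.
  by apply: subset_trans KE _; exact: sub_addr.
move=> u [Nu [_ [w _ <-] [z Ez uE]]]; apply: NE; split=> //.
rewrite -uE; apply: submodD => //; apply: (Gk n).
have axn : ideal_exp a n (x ^+ n).
  elim: (n) => //= i IH; apply: sub_ideal_gen.
  by exists x => //; exists (x ^+ i); rewrite // exprS.
rewrite /G /= addnC exprD -scalerA.
have -> : x ^+ k *: w = u - z by rewrite -uE addrK.
rewrite scalerBr; apply: submodB => //; last exact: submodZ.
exact/KE/aNK.
Qed.

End ArtinRees.

(** * Lifting graded resolutions *)

Section Lifting.
Variables (R : comNzRingType) (a : idealr R).
Local Notation Gr := (assoc_graded a).
Local Notation "'a^z' n" := (ideal_expz a n) (at level 10).
Implicit Types (s t : seq int) (n : int).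

Lemma expz_ideal n : is_ideal (a^z n).
Proof. by case: n => n /=; [exact: ideal_exp_ideal | split]. Qed.

Lemma ideal_exp_le i j : (i <= j)%N -> ideal_exp [set` a] j `<=` ideal_exp [set` a] i.
Proof.
move=> /subnKC <-; elim: (j - i)%N => [|k IH]; first by rewrite addn0.
by rewrite addnS; apply: subset_trans IH; exact/ideal_expS/idealr_is_ideal.
Qed.

(** In negative degrees the powers are the whole ring, so the inclusions and the
    product rules for powers and classes extend to all integers; classes vanish
    there. *)
Lemma expz_le n n' : n <= n' -> a^z n' `<=` a^z n.
Proof. by case: n => [i|i]; case: n' => [j|j] //=; exact: ideal_exp_le. Qed.

Lemma expzM n n' x y : a^z n x -> a^z n' y -> a^z (n + n') (x * y).
Proof.
have neg i k z u : a^z k u -> a^z (Negz i + k) (z * u).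
  move=> ku; have [_ _ aM] := expz_ideal (Negz i + k); apply: aM.
  by apply: expz_le ku; lia.
case: n n' => [i|i] [j|j] ax ay; last 3 first.
- by rewrite addrC mulrC; exact: neg.
- exact: neg.
- exact: neg.
exact: (ideal_expM (idealr_is_ideal a)).
Qed.

Lemma gr_classz_eq0 n x : a^z n x -> gr_classz a n x = 0 <-> a^z (n + 1) x.
Proof.
case: n => [i|[|i]] ax //.
by rewrite /= (gr_class_eq0 ax) addn1.
Qed.

Lemma gr_classzD n x y : a^z n x -> a^z n y ->
  gr_classz a n (x + y) = gr_classz a n x + gr_classz a n y.
Proof. by case: n => [i|i] ax ay; [exact: gr_classD | rewrite /= addr0]. Qed.

Lemma gr_classz0 n : gr_classz a n 0 = 0.
Proof. by apply/gr_classz_eq0; have [] := expz_ideal n; have [] := expz_ideal (n + 1). Qed.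

Lemma gr_classzN n x : a^z n x -> gr_classz a n (- x) = - gr_classz a n x.
Proof.
move=> ax; apply/eqP; rewrite -addr_eq0 -gr_classzD //; first by rewrite addNr gr_classz0.
exact: ideal_opp (expz_ideal n) ax.
Qed.

Lemma gr_classz_sum n (T : Type) (r : seq T) (F : T -> R) :
  (forall i, a^z n (F i)) ->
  gr_classz a n (\sum_(i <- r) F i) = \sum_(i <- r) gr_classz a n (F i).
Proof.
move=> aF; elim: r => [|i r IH]; first by rewrite !big_nil gr_classz0.
by rewrite !big_cons gr_classzD ?IH //; apply: ideal_sum => //; exact: expz_ideal.
Qed.

Lemma gr_classzM n n' x y : a^z n x -> a^z n' y ->
  gr_classz a (n + n') (x * y) = gr_classz a n x * gr_classz a n' y.
Proof.
have neg i k z u : a^z k u -> gr_classz a (Negz i + k) (z * u) = 0.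
  move=> ku; have [_ _ aM] := expz_ideal (Negz i + k).
  have [_ _ aM'] := expz_ideal (Negz i + k + 1).
  apply/gr_classz_eq0; first by apply: aM; apply: expz_le ku; lia.
  by apply: aM'; apply: expz_le ku; lia.
case: n n' => [i|i] [j|j] ax ay; last 3 first.
- by rewrite addrC mulrC neg //= mulr0.
- by rewrite neg //= mul0r.
- by rewrite neg //= mul0r.
exact: gr_classM.
Qed.

(** The zero value in negative degrees matches the vanishing of [gr_classz]. *)
Definition rees_coef n (p : rees a) : R :=
  if n is Posz i then (p : {poly R})`_i else 0.

Lemma rees_coefP n p : a^z n (rees_coef n p).
Proof. by case: n => i //=; exact: reesP. Qed.

(** A fixed name for the quotient map, since rewriting does not identify the
    convertible forms in which it occurs. *)
Definition gr_proj (p : rees a) : Gr := \pi_(assoc_graded a) p.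

Lemma gr_projP x : exists p, x = gr_proj p.
Proof. by elim/quotW: x => p; exists p. Qed.

Lemma gr_proj0 : gr_proj 0 = 0.
Proof. exact: (rmorph0 (\pi_{ideal_quot rees_shift (a := a)})). Qed.

Lemma gr_proj1 : gr_proj 1 = 1.
Proof. exact: (rmorph1 (\pi_{ideal_quot rees_shift (a := a)})). Qed.

Lemma gr_projD p q : gr_proj (p + q) = gr_proj p + gr_proj q.
Proof. exact: (rmorphD (\pi_{ideal_quot rees_shift (a := a)})). Qed.

Lemma gr_projM p q : gr_proj (p * q) = gr_proj p * gr_proj q.
Proof. exact: (rmorphM (\pi_{ideal_quot rees_shift (a := a)})). Qed.

Lemma gr_class_proj i x (ax : ideal_exp [set` a] i x) :
  gr_class a i x = gr_proj (Rees (in_rees_monomial ax)).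
Proof. exact: gr_classE. Qed.

(** The homogeneous component of degree n; by [component_proj] it does not depend
    on the representative. *)
Definition component n (x : Gr) : Gr := gr_classz a n (rees_coef n (repr x)).

Arguments component : simpl never.

Lemma component_proj n (p : rees a) :
  component n (gr_proj p) = gr_classz a n (rees_coef n p).
Proof.
case: n => [i|] //; apply/eqP; rewrite /component -subr_eq0 -gr_classzN; last first.
  exact: rees_coefP.
rewrite -gr_classzD; last 2 first.
- exact: rees_coefP.
- exact: ideal_opp (expz_ideal _) (rees_coefP _ _).
apply/eqP/gr_classz_eq0.
  by apply: (@submodB R R^o _ _ _ (expz_ideal i)); exact: rees_coefP.
set q := repr _; have : q - p \in rees_shift (a := a).
  by rewrite Quotient.idealrBE; apply/eqP; exact: reprK.
by move=> /asboolP /(_ i); rewrite /= coefB addn1.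
Qed.

Lemma componentD n x y : component n (x + y) = component n x + component n y.
Proof.
have [p ->] := gr_projP x; have [q ->] := gr_projP y.
rewrite -gr_projD !component_proj -gr_classzD; try exact: rees_coefP.
by case: n => i //=; rewrite ?coefD ?addr0.
Qed.

Lemma component_id n x : gr_piece a n x -> component n x = x.
Proof.
case=> y ay <-; case: n ay => [i|i] ay //.
by rewrite /= (gr_class_proj ay) component_proj /= coefZ coefXn eqxx mulr1 (gr_class_proj ay).
Qed.

Lemma component0 n : component n 0 = 0.
Proof. by apply: component_id; exists 0; [case: (expz_ideal n) | exact: gr_classz0]. Qed.

Lemma component_sum n (T : Type) (r : seq T) (F : T -> Gr) :
  component n (\sum_(i <- r) F i) = \sum_(i <- r) component n (F i).
Proof.
elim: r => [|i r IH]; first by rewrite !big_nil component0.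
by rewrite !big_cons componentD IH.
Qed.

(** Multiplication by a homogeneous element shifts components, which makes the
    maps of a graded resolution commute with taking homogeneous parts. *)
Lemma componentM n n' x y : gr_piece a n' y ->
  component (n + n') (x * y) = component n x * y.
Proof.
case: n' => [j|j] [z az <-]; last by rewrite /= !mulr0 component0.
have [p ->] := gr_projP x; rewrite component_proj /= (gr_class_proj az).
rewrite -gr_projM component_proj -(gr_class_proj az).
case: n => [i|i] /=; last first.
  rewrite mul0r; case E : (Negz i + j) => [k|k] //=.
  have kj : (k < j)%N by lia.
  by rewrite -scalerAr coefZ coefMXn kj mulr0; exact: (gr_classz0 k).
rewrite -scalerAr coefZ coefMXn ltnNge leq_addl /= addnK mulrC.
exact: (gr_classM (reesP p i) az).
Qed.

(** The class of g in F_n / F_(n+1), which is in_a(g) when g has order n and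
    zero when its order is larger. *)
Definition symbol s n (g : 'rV[R]_(size s)) : 'rV[Gr]_(size s) :=
  \row_j gr_classz a (n - s`_j) (g 0 j).

Lemma filtration_submod s n : @is_submod R 'rV_(size s) (filtration a n).
Proof.
split=> [j|u v Fu Fv j|c u Fu j]; have [a0 aD aM] := expz_ideal (n - s`_j); rewrite mxE //.
  by apply: aD; [exact: Fu | exact: Fv].
by apply: aM; exact: Fu.
Qed.

Lemma filtration_le s n n' (g : 'rV[R]_(size s)) :
  n <= n' -> filtration a n' g -> filtration a n g.
Proof. by move=> nn Fg j; apply: expz_le (Fg j); lia. Qed.

Lemma symbol_eq0 s n (g : 'rV[R]_(size s)) :
  filtration a n g -> symbol n g = 0 <-> filtration a (n + 1) g.
Proof.
move=> Fg; split=> [/rowP s0 j|Fg1].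
  have := s0 j; rewrite !mxE => /(gr_classz_eq0 (Fg j)).
  by rewrite addrAC.
apply/rowP => j; rewrite !mxE; apply/(gr_classz_eq0 (Fg j)).
by have := Fg1 j; rewrite addrAC.
Qed.

Lemma symbolB s n (g h : 'rV[R]_(size s)) :
  filtration a n g -> filtration a n h -> symbol n (g - h) = symbol n g - symbol n h.
Proof.
move=> Fg Fh; apply/rowP => j; rewrite !mxE gr_classzD ?gr_classzN //.
exact: ideal_opp (expz_ideal _) _.
Qed.

Lemma graded_partP s n (h : 'rV[Gr]_(size s)) :
  graded_part a n h <-> exists2 g, filtration a n g & symbol n g = h.
Proof.
split=> [gh|[g Fg <-] j]; last by rewrite mxE; exists (g 0 j).
have /choice[f fP] (j : 'I_(size s)) : exists x,
    a^z (n - s`_j) x /\ gr_classz a (n - s`_j) x = h 0 j.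
  by have [x ax xE] := gh j; exists x.
exists (\row_j f j); first by move=> j; rewrite mxE; exact: (fP j).1.
by apply/rowP => j; rewrite !mxE; exact: (fP j).2.
Qed.

(** The last clause is needed because the initial form of a nonzero row is never
    zero: zero rows of C must be lifted to zero. *)
Definition lifts s t (D : 'M[R]_(size t, size s)) (C : 'M[Gr]_(size t, size s)) : Prop :=
  forall j : 'I_(size t),
    [/\ filtration a t`_j (row j D), symbol t`_j (row j D) = row j C
      & row j C = 0 -> row j D = 0].

(** D is strict for the filtrations: this is what passes exactness from the
    graded complex to the filtered one and back. *)
Definition strict s t (D : 'M[R]_(size t, size s)) : Prop :=
  forall n v, row_image D v -> filtration a n v -> exists2 w, filtration a n w & v = w *m D.

Section Lifts.
Variables (s t : seq int) (D : 'M[R]_(size t, size s)) (C : 'M[Gr]_(size t, size s)).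
Hypothesis DC : lifts D C.

Let DE (j : 'I_(size t)) (k : 'I_(size s)) : a^z (t`_j - s`_k) (D j k).
Proof. by have [/(_ k) + _ _] := DC j; rewrite mxE. Qed.

Let CE (j : 'I_(size t)) (k : 'I_(size s)) : gr_classz a (t`_j - s`_k) (D j k) = C j k.
Proof. by have [_ /rowP /(_ k) + _] := DC j; rewrite !mxE. Qed.

Lemma lifts_filtration n w : filtration a n w -> filtration a n (w *m D).
Proof.
move=> Fw k; rewrite mxE; apply: ideal_sum => [|j _]; first exact: expz_ideal.
have -> : n - s`_k = (n - t`_j) + (t`_j - s`_k) by lia.
exact: expzM (Fw j) (DE j k).
Qed.

Lemma lifts_symbol n w : filtration a n w -> symbol n (w *m D) = symbol n w *m C.
Proof.
move=> Fw; apply/rowP => k; rewrite !mxE.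
have eqn (j : 'I_(size t)) : n - s`_k = (n - t`_j) + (t`_j - s`_k) by lia.
rewrite gr_classz_sum => [|j]; last by rewrite (eqn j); exact: expzM (Fw j) (DE j k).
by apply: eq_bigr => j _; rewrite (eqn j) gr_classzM // CE mxE.
Qed.

(** The symbol in the degree of the basis element is the initial form: if it is
    nonzero, that degree is the order. *)
Lemma lifts_init_form j : is_init_form a (row j D) (row j C).
Proof.
have [FD sD C0] := DC j; have [cj|cj] := pselect (row j C = 0).
  by left; split=> //; exact: C0.
right; split.
  move=> d0; apply: cj; rewrite -sD d0; apply/rowP => k.
  by rewrite !mxE gr_classz0.
exists t`_j; last by rewrite -sD.
split=> // n Fn; rewrite leNgt; apply/negP => lt; apply: cj.
by rewrite -sD; apply/(symbol_eq0 FD); apply: filtration_le Fn; lia.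
Qed.

End Lifts.

(** Take homogeneous components of the entries of v and lift them to R. *)
Lemma homogeneous_preimage s t (C : 'M[Gr]_(size t, size s)) n v :
  (forall j : 'I_(size t), graded_part a t`_j (row j C)) -> graded_part a n (v *m C) ->
  exists2 w, filtration a n w & symbol n w *m C = v *m C.
Proof.
move=> gC gv.
exists (\row_j rees_coef (n - t`_j) (repr (v 0 j))).
  by move=> j; rewrite mxE; exact: rees_coefP.
apply/rowP => k; rewrite -[RHS](component_id (gv k)) !mxE component_sum.
apply: eq_bigr => j _; rewrite !mxE -/(component _ _).
have -> : n - s`_k = (n - t`_j) + (t`_j - s`_k) by lia.
by rewrite componentM //; have := gC j k; rewrite mxE.
Qed.

Hypotheses (noeR : noetherian_ring R) (la : is_local [set` a]).

Lemma shift_bound s : exists B : nat, forall j : 'I_(size s), - B%:Z <= s`_j <= B%:Z.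
Proof.
exists (\max_(i < size s) `|(s`_i)%R|%N) => j.
have := leq_bigmax (F := fun i : 'I_(size s) => `|(s`_i)%R|%N) j.
by move: (\max_(_ < _) _)%N => M /=; lia.
Qed.

(** Artin-Rees for N, read on the filtration: since the shifts are bounded, an
    element of F_n has all its entries in a deep power of a when n is large. *)
Lemma deep_in_power_multiple s (N : set 'rV[R]_(size s)) g e :
  is_submod N -> (forall v, N v <-> span setT g v) ->
  exists n, forall v, N v -> filtration a n v -> span (ideal_exp [set` a] e) g v.
Proof.
move=> mN gN; have eI := ideal_exp_ideal [set` a] e.
have [||||||E [m [mE aE NE]]] :=
    @artin_rees R noeR _ N (span (ideal_exp [set` a] e) g) [set` a] e.
- exact: noetherian_rV.
- by [].
- exact: span_submod.
- exact: idealr_is_ideal.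
- by apply: span_sub => // c x _ xg; apply: submodZ => //; exact/gN/spanT_mem.
- by move=> c v ac /gN; exact: span_mull.
have [B BP] := shift_bound s; exists (m%:Z + B%:Z) => v Nv Fv; apply: NE; split=> //.
rewrite [v]row_sum_delta; elim/big_ind: _ => [||j _].
- by case: mE.
- by move=> *; exact: submodD.
- by apply: aE; apply: (@expz_le m _ _ _ (Fv j)); have := BP j; lia.
Qed.

(** Iterating the hypothesis approximates elements of N by images under D to any
    order. By [deep_in_power_multiple] the error can be put into a N, which gives
    N = im D by Nakayama, and into a^e N = D(a^e R^t), which for large e lies in
    D(F_n) and gives strictness. *)
Lemma image_of_approximation s t (N : set 'rV[R]_(size s)) (D : 'M[R]_(size t, size s)) :
  is_submod N -> (forall j, N (row j D)) ->
  (forall n v, N v -> filtration a n v ->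
     exists2 w, filtration a n w & filtration a (n + 1) (v - w *m D)) ->
  N = row_image D /\ strict D.
Proof.
move=> mN ND step.
have imN w : N (w *m D).
  rewrite mulmx_sum_row; elim/big_ind: _ => [||j _]; first by case: mN.
    by move=> *; exact: submodD.
  exact: submodZ.
have iter k n v : N v -> filtration a n v ->
    exists2 w, filtration a n w & filtration a (n + k%:Z) (v - w *m D).
  move=> Nv Fv; elim: k => [|k [w Fw Fvw]].
    by exists 0; [case: (filtration_submod t n) | rewrite mul0mx !subr0].
  have [u Fu Fvu] := step _ _ (submodB mN Nv (imN w)) Fvw.
  exists (w + u).
    by apply: (submodD (filtration_submod _ _)) => //; apply: filtration_le Fu; lia.
  rewrite mulmxDl opprD addrA; have -> // : n + k.+1%:Z = n + k%:Z + 1 by lia.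
have reach n n' v : N v -> filtration a n v ->
    exists2 w, filtration a n w & filtration a n' (v - w *m D).
  move=> Nv /(iter `|n' - n|%N n v Nv) [w Fw Fvw]; exists w => //.
  by apply: filtration_le Fvw; lia.
have [g gN] := noetherian_rV noeR mN.
have [aI _ _] := la.
have NI : N `<=` row_image D.
  have [n nP] := deep_in_power_multiple 1 mN gN.
  apply: (nakayama_local la (row_image_submod D) gN) => v Nv.
  (* Below all shifts the filtration is the whole module. *)
  have [B BP] := shift_bound s.
  have [|w _ /(nP _ (submodB mN Nv (imN w))) vw] := reach (- B%:Z) n v Nv.
    by move=> j; apply: (@expz_le _ 0) => //; have := BP j; lia.
  exists (w *m D); first by exists w.
  exists (v - w *m D); last by rewrite addrC subrK.
  apply: span_sub vw => [|c x ac xg]; first exact: span_submod.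
  apply: span_mem => //; apply: ideal_gen_sub ac => // _ [y ay [z _ <-]].
  by rewrite /= mulrC; exact: idealMr.
split; first by apply/seteqP; split=> // _ [w _ <-]; exact: imN.
move=> n v [u _ /= uE] Fv; have Nv : N v by rewrite -uE; exact: imN.
have [B BP] := shift_bound t.
have [n' n'P] := deep_in_power_multiple (`|n| + B)%N mN gN.
have [w Fw /(n'P _ (submodB mN Nv (imN w))) vw] := reach n n' v Nv Fv.
suff [x Fx xE] : exists2 x, filtration a n x & v - w *m D = x *m D.
  exists (w + x); first exact: (submodD (filtration_submod _ _)).
  by rewrite mulmxDl -xE addrC subrK.
have mX : is_submod [set y | exists2 x, filtration a n x & y = x *m D].
  have := image_submod (mulmxr D) (filtration_submod t n).
  have -> // : [set mulmxr D x | x in filtration a n] =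
      [set y | exists2 x, filtration a n x & y = x *m D].
  by apply/seteqP; split=> [_ [x Fx <-]|y [x Fx ->]]; exists x.
apply: (span_sub mX _ vw) => c y ac /spanT_mem/gN/NI[x _ /= <-].
exists (c *: x); last by rewrite scalemxAl.
move=> j; rewrite mxE mulrC.
have [_ _ aM] := expz_ideal (n - t`_j); apply: aM.
by apply: (@expz_le _ (`|n| + B)%N%:Z) ac; have := BP j; lia.
Qed.

(** The inductive step of the lifting, for a submodule N whose symbols are
    generated by the rows of C. It applies both to I, with in_a(I), and to the
    kernel of a lifted matrix, with the kernel of the graded one. *)
Theorem lift_generators s t (N : set 'rV[R]_(size s)) (C : 'M[Gr]_(size t, size s)) :
  is_submod N -> (forall j : 'I_(size t), graded_part a t`_j (row j C)) ->
  (forall j : 'I_(size t), exists g,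
    [/\ N g, filtration a t`_j g & symbol t`_j g = row j C]) ->
  (forall n v, N v -> filtration a n v -> row_image C (symbol n v)) ->
  exists D, [/\ lifts D C, N = row_image D & strict D].
Proof.
move=> mN gC rowsN symbolN.
have /choice[f fP] (j : 'I_(size t)) : exists g, [/\ N g, filtration a t`_j g,
    symbol t`_j g = row j C & row j C = 0 -> g = 0].
  have [c0|c0] := pselect (row j C = 0); last by have [g [? ? ?]] := rowsN j; exists g.
  exists 0; split=> //; first by case: mN.
    by case: (filtration_submod s t`_j).
  by rewrite c0; apply/rowP => k; rewrite !mxE gr_classz0.
pose D := \matrix_j f j.
have rowD j : row j D = f j by rewrite rowK.
have DC : lifts D C by move=> j; rewrite rowD; have [] := fP j.
have [|n v Nv Fv|ND sD] := @image_of_approximation s t N D mN; last by exists D.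
  by move=> j; rewrite rowD; have [] := fP j.
have [u _ /= uE] := symbolN _ _ Nv Fv.
have [|w Fw wE] := @homogeneous_preimage _ _ C n u gC.
  by rewrite uE; apply/graded_partP; exists v.
exists w => //; apply/symbol_eq0.
  apply: (submodB (filtration_submod _ _)) => //; exact: lifts_filtration DC _ _ _.
rewrite symbolB //; last exact: lifts_filtration DC _ _ _.
by rewrite (lifts_symbol DC) // wE uE subrr.
Qed.

(** Let g lift a row of C'. As that row is a syzygy of C, the image of g under D
    has order larger than expected; by strictness it is also the image of some g'
    of larger order, and g - g' is a syzygy of D with the same symbol. *)
Corollary lift_syzygies s t (u : seq int) (C : 'M[Gr]_(size t, size s))
    (C' : 'M[Gr]_(size u, size t)) (D : 'M[R]_(size t, size s)) :
  (forall v : 'rV_(size t), v *m C = 0 <-> exists w : 'rV_(size u), v = w *m C') ->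
  (forall j : 'I_(size u), graded_part a u`_j (row j C')) ->
  lifts D C -> strict D ->
  exists D', [/\ lifts D' C', row_kernel D = row_image D' & strict D'].
Proof.
move=> exC gC' DC sD; apply: lift_generators => //.
- exact: row_kernel_submod.
- move=> j; have /graded_partP[g Fg gE] := gC' j.
  have gD : filtration a (u`_j + 1) (g *m D).
    apply/symbol_eq0; first exact: lifts_filtration DC _ _ _.
    rewrite (lifts_symbol DC) // gE; apply/exC; exists (delta_mx 0 j).
    by rewrite rowE.
  have [|g' Fg' g'E] := sD _ _ _ gD; first by exists g.
  have Fg'' : filtration a u`_j g' by apply: filtration_le Fg'; lia.
  exists (g - g'); split.
  + by rewrite /row_kernel /= mulmxBl g'E subrr.
  + exact: (submodB (filtration_submod _ _)).
  + by rewrite symbolB // (_ : symbol _ g' = 0) ?subr0 //; apply/symbol_eq0.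
- move=> n v vD Fv; have /exC[w wE] : symbol n v *m C = 0.
    rewrite -(lifts_symbol DC) // vD; apply/rowP => k; by rewrite !mxE gr_classz0.
  by exists w.
Qed.

(** The elements of Gr_a(R) represented by a family of coefficients in I form an
    ideal. Hence a homogeneous element of in_a(I) is the class of an element of
    I, and not only a combination of such classes. *)
Lemma init_ideal_coef (I : set R) h : is_ideal I -> init_ideal a I h ->
  exists2 p : rees a, h = gr_proj p & forall i, I (p : {poly R})`_i.
Proof.
move=> idI; have [I0 ID IM] := idI; move: h; apply: ideal_gen_sub.
  split=> /= [|_ _ [p -> pI] [q -> qI]|x _ [p -> pI]].
  - exists 0; last by move=> i; rewrite coef0.
    by rewrite -gr_proj0.
  - exists (p + q); last by move=> i; rewrite /= coefD; exact: ID.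
    by rewrite -gr_projD.
  - have [q ->] := gr_projP x; exists (q * p).
      by rewrite -gr_projM.
    by move=> i; rewrite /= coefM; apply: ideal_sum => // j _; exact: IM.
move=> _ [c [n [Ic _ ac _ ->]]] /=.
exists (Rees (in_rees_monomial ac)); first by rewrite (gr_class_proj ac).
by move=> i /=; rewrite coefZ coefXn mulrC; exact: IM.
Qed.

Lemma init_ideal_class (I : set R) n c :
  I c -> a^z n c -> init_ideal a I (gr_classz a n c).
Proof.
have [i0 _ _] : is_ideal (init_ideal a I) by exact: ideal_gen_ideal.
case: n => [n|n] Ic ac //.
have [ac1|ac1] := pselect (ideal_exp [set` a] n.+1 c).
  by rewrite /= (gr_class_eq0 ac).2.
apply: sub_ideal_gen; exists c, n; split=> // c0; apply: ac1; rewrite c0.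
by have [] := ideal_exp_ideal [set` a] n.+1.
Qed.

Lemma lift_init_ideal s t (I : set R) (C : 'M[Gr]_(size t, size s)) :
  is_ideal I -> s = [:: 0] ->
  (forall x, init_ideal a I x <-> exists v : 'rV_(size t), v *m C = const_mx x) ->
  (forall j : 'I_(size t), graded_part a t`_j (row j C)) ->
  exists D, [/\ lifts D C,
    forall x, I x <-> exists v : 'rV_(size t), v *m D = const_mx x & strict D].
Proof.
move=> idI sE; subst s => CI gC; have [I0 ID IM] := idI.
have constE (T : nzRingType) (v : 'rV[T]_1) : v = const_mx (v 0 0).
  by apply/rowP => k; rewrite !mxE ord1.
have [||j|n v Iv Fv|D [DC ND sD]] :=
    @lift_generators [:: 0] t [set v | I (v 0 0)] C.
- by split=> [|u v Iu Iv|c u Iu] /=; rewrite mxE //; [exact: ID | exact: IM].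
- exact: gC.
- have /init_ideal_coef -/(_ idI) [p pE pI] : init_ideal a I (row j C 0 0).
    by apply/CI; exists (delta_mx 0 j); rewrite -rowE; exact: constE.
  have /component_id := gC j 0; rewrite pE component_proj => rE.
  exists (const_mx (rees_coef (t`_j - [:: 0]`_(ord0 : 'I_1)) p)); split.
  + by rewrite /= mxE; case: (_ - _) => //= i; exact: pI.
  + by move=> k; rewrite mxE !ord1; exact: rees_coefP.
  + by apply/rowP => k; rewrite mxE mxE !ord1 rE -pE.
- have /CI[w wE] := init_ideal_class Iv (Fv 0).
  by exists w => //=; rewrite wE; apply/rowP => k; rewrite !mxE !ord1.
exists D; split=> // x.
have := congr1 (fun N => N (const_mx x)) ND; rewrite /= mxE => ->.
by split=> [[v _ vE]|[v vE]]; exists v.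
Qed.

Lemma graded_delta s (j : 'I_(size s)) : graded_part a s`_j (delta_mx 0 j : 'rV[Gr]_(size s)).
Proof.
apply/graded_partP; exists (delta_mx 0 j).
  move=> k; rewrite mxE eqxx /=; case: eqVneq => [->|_]; last first.
    by case: (expz_ideal (s`_j - s`_k)).
  by rewrite subrr.
apply/rowP => k; rewrite !mxE eqxx /=; case: eqVneq => [->|_]; last exact: gr_classz0.
rewrite subrr /= (gr_class_proj (i := 0) (I : ideal_exp [set` a] 0 1)).
rewrite -gr_proj1; congr (\pi).
by apply: val_inj; rewrite /= scale1r.
Qed.

(** The matrices are built by recursion, each from its predecessor, starting
    with the lift of generators of in_a(I). *)
Theorem lift_graded_resolution (I : set R) (s : nat -> seq int)
    (C : forall i, 'M[Gr]_(size (s i.+1), size (s i))) :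
  is_ideal I -> is_graded_resolution a (init_ideal a I) s C ->
  exists2 D : forall i, 'M[R]_(size (s i.+1), size (s i)),
    is_filtered_resolution a I s D &
    forall i j, is_init_form a (row j (D i)) (row j (C i)).
Proof.
move=> idI [s0 [_ CI exC] gC].
have rowC i (j : 'I_(size (s i.+1))) : graded_part a (s i.+1)`_j (row j (C i)).
  by rewrite rowE; apply: gC; exact: graded_delta.
pose good i (D : 'M[R]_(size (s i.+1), size (s i))) := lifts D (C i) /\ strict D.
have [D0 [DC0 D0I sD0]] := lift_init_ideal idI s0 CI (rowC 0%N).
have next i (D : {D | good i D}) :
    {D' : {D' | good i.+1 D'} | row_kernel (sval D) = row_image (sval D')}.
  apply: cid; have [DC sD] := svalP D.
  have [D' [DC' DD' sD']] := lift_syzygies (exC i) (rowC i.+1) DC sD.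
  by exists (exist _ D' (conj DC' sD')).
pose D := nat_rect (fun i => {D | good i D}) (exist _ D0 (conj DC0 sD0))
  (fun i D => sval (next i D)).
exists (fun i => sval (D i)); last first.
  by move=> i j; apply: lifts_init_form; case: (svalP (D i)).
split=> //.
  split; first by rewrite s0.
    exact: D0I.
  move=> i v; have := congr1 (fun N => N v) (svalP (next i (D i))).
  rewrite /row_kernel /= => ->.
  by split=> [[w _ wE]|[w wE]]; exists w.
by move=> i n v; exact: (lifts_filtration (svalP (D i)).1).
Qed.

End Lifting.

(** * The principal ideal theorem *)

Section PrincipalIdeal.
Variable R : comNzRingType.
Hypothesis noeR : noetherian_ring R.
Implicit Type P : set R.

Definition principal (x : R) : set R^o := range (fun b => x * b).

Lemma principal_submod x : is_submod (principal x).
Proof.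
split; first by exists 0; rewrite ?mulr0.
  by move=> _ _ [b _ <-] [c _ <-]; exists (b + c); rewrite ?mulrDr.
by move=> c _ [b _ <-]; exists (c * b); rewrite // mulrCA.
Qed.

(** The descending sequence F becomes stationary, up to saturation at P, in the
    interval of submodules between B and C. *)
Definition stabilizes_in (F : nat -> set R^o) P (B C : set R^o) : Prop :=
  exists n0, forall n, (n0 <= n)%N -> F n `&` C `<=` saturation P (submod_add (F n.+1) B).

(** A colon ideal that is maximal among those of elements g outside the
    saturation of C is prime: the associated primes of R / C at P. *)
Lemma prime_colon P (C : set R^o) : is_prime P -> is_submod C -> C `<=` P ->
  exists2 g, ~ C g & is_prime [set t | C (t * g)] /\ [set t | C (t * g)] `<=` P.
Proof.
move=> pP mC CP; have [iP P1 PM] := pP.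
pose colon g : set R^o := [set t | C (t * g)].
pose F : set (set R^o) := [set K | exists2 g, ~ saturation P C g & K = colon g].
have mcolon g : is_submod (colon g).
  split=> [|s t Cs Ct|c t Ct]; rewrite /colon /=.
  - by rewrite mul0r; case: mC.
  - by rewrite mulrDl; exact: (submodD mC).
  - by rewrite -mulrA; exact: (submodZ c mC).
have [||_ [g Cg ->] maxF] := @noetherian_max _ _ F noeR.
- by move=> _ [g _ ->].
- exists (colon 1); exists 1 => // -[s Ps Cs]; apply: Ps; apply: CP.
  by rewrite -[s](mulr1 s).
have sub_colon s : ~ saturation P C (s * g) -> colon (s * g) `<=` colon g.
  move=> sg; apply: maxF; first by exists (s * g).
  by move=> t Ct; rewrite /colon /= mulrCA; exact: (submodZ s mC).
have notC : ~ C g by move=> Cg'; apply: Cg; exact: sub_saturation.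
exists g => //; split; last first.
  by move=> t Ct; apply: contrapT => Pt; apply: Cg; exists t.
split; first exact: mcolon.
  by rewrite /= mul1r.
move=> s t /=; rewrite -mulrA => Cst.
case: (pselect (saturation P C (t * g))) => [[u Pu Cu]|tg]; last first.
  by left; exact: (sub_colon t).
right; apply: (sub_colon u); last by rewrite /colon /= mulrCA.
by move=> [v Pv Cv]; apply: Cg; exists (v * u); [exact: prime_notM | rewrite -scalerA].
Qed.

(** The localization of R / (P0 + xR) at P2 has P2 as its only prime, so it is
    Artinian and descending sequences of ideals become stationary there. Instead
    of lengths, the proof takes C maximal such that F stabilizes between
    X0 = P0 + xR and C. If C stayed inside P2, [prime_colon] and the minimality of
    P2 would give g outside C with P2 g inside C, and F would stabilize between C
    and C + gR too, as this step has length one at P2. *)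
Lemma saturated_stabilization P0 P2 x (F : nat -> set R^o) :
  is_prime P0 -> is_prime P2 -> P0 `<=` P2 -> P2 x ->
  (forall P, is_prime P -> P0 `<=` P -> P x -> P `<=` P2 -> P2 `<=` P) ->
  (forall n, is_submod (F n)) -> (forall n, F n.+1 `<=` F n) ->
  exists n, F n `<=` saturation P2
    (submod_add (F n.+1) (submod_add (P0 : set R^o) (principal x))).
Proof.
move=> pP0 pP2 P02 P2x minP2 mF FS; have [iP2 _ _] := pP2.
pose X0 := submod_add (P0 : set R^o) (principal x).
have mX0 : is_submod X0 by apply: submod_addP; [case: pP0 | exact: principal_submod].
have Fle n m : (n <= m)%N -> F m `<=` F n.
  move=> nm; rewrite -(subnKC nm); elim: (m - n)%N => [|k IH]; first by rewrite addn0.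
  by rewrite addnS; apply: subset_trans (FS _) IH.
pose T : set (set R^o) := [set C | [/\ is_submod C, X0 `<=` C & stabilizes_in F P2 X0 C]].
have mFX n : is_submod (submod_add (F n) X0) by exact: submod_addP.
have [||C [mC XC [n0 stC]] maxC] := @noetherian_max _ _ T noeR.
- by move=> C [].
- exists X0; split=> //; exists 0%N => n _ y [_ Xy].
  by apply: sub_saturation => //; exact: sub_addr.
suff [s Cs P2s] : exists2 s, C s & ~ P2 s.
  exists n0 => r Fr; apply: saturation_id => //; exists s => //.
  apply: stC => //; split; first exact: submodZ.
  by rewrite -[s *: r]/(s * r) mulrC; exact: (submodZ r mC).
apply: contrapT => noS.
have CP : C `<=` P2 by move=> s Cs; apply: contrapT => Ps; apply: noS; exists s.
have [g Cg [pg gP]] := prime_colon pP2 mC CP.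
have Pg : P2 `<=` [set t | C (t * g)].
  apply: minP2 => //.
    move=> p Pp /=; rewrite mulrC; apply: (submodZ g mC); apply: XC.
    exact: (sub_addl (principal_submod x)).
  rewrite /= mulrC; apply: (submodZ g mC); apply: XC.
  by apply: sub_addr; [case: pP0 | exists 1; rewrite // mulr1].
apply: Cg; have mCg := submod_addP mC (principal_submod g).
apply: (maxC (submod_add C (principal g))); last 2 first.
- exact: (sub_addl (principal_submod g)).
- by apply: sub_addr => //; exists 1; rewrite // mulr1.
split=> //; first exact: subset_trans XC (sub_addl (principal_submod g)).
have mFC n : is_submod (submod_add (F n) C) by exact: submod_addP.
have [big|/existsNP [n1 n1P]] := pselect (forall n, saturation P2 (submod_add (F n) C) g).
(* Every F n + C contains g up to saturation: elements of F n are moved to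
   F n.+1 modulo C. *)
- exists n0 => n n0n y [Fy [c Cc [z [t _ zE] yE]]]; subst z y.
  have [r Pr [f Ff [c' Cc' rg]]] := big n.+1.
  apply: saturation_id => //; exists r => //.
  have yE : r *: (c + g * t : R^o) = t *: f + (r *: c + t *: c').
    by rewrite addrCA -scalerDr rg scalerDr; congr (_ + _);
       rewrite !/(_ *: _) /=; ring.
  have mS := saturation_submod pP2 (mFX n.+1).
  rewrite yE; apply: submodD => //.
    apply: sub_saturation => //; apply: sub_addl => //; exact: submodZ.
  apply: stC => //; split; last by apply: submodD => //; exact: submodZ.
  apply: (@submod_addl _ _ _ (t *: f)) => //; first by apply: submodZ => //; exact: FS.
  by rewrite -yE; exact: submodZ.
(* Some F n1 + C does not contain g: from n1 on, F n meets C + gR inside C. *)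
- exists (maxn n0 n1) => n; rewrite geq_max => /andP[n0n n1n] y [Fy yC].
  apply: stC => //; split=> //; case: yC Fy => c Cc [_ [t _ <-] <-] Fy.
  apply: (submodD mC) => //; rewrite mulrC; apply: Pg; apply: contrapT => Pt.
  apply: n1P; exists t => //.
  have -> : t *: (g : R^o) = (c + g * t) - c by rewrite addrC addKr mulrC.
  by exists (c + g * t); [exact: Fle Fy | exists (- c); first exact: submodN].
Qed.

(** If P2 is minimal over P0 + xR, no prime lies strictly between P0 and P2. This
    is Krull's proof with the symbolic powers F n of P1 modulo P0. By
    [saturated_stabilization], F n is contained in F n.+1 + xR at P2 for some n;
    as x is not in P1, the multiple of x can be taken in x F n, so Nakayama at P2
    gives F n = F n.+1. Then Nakayama at P1 shows that the n-th power of P1 lies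
    in P0. *)
Theorem krull_principal_ideal P0 P1 P2 x :
  is_prime P0 -> is_prime P1 -> is_prime P2 -> P0 `<=` P1 -> P1 `<=` P2 ->
  P2 x -> ~ P1 x ->
  (forall P, is_prime P -> P0 `<=` P -> P x -> P `<=` P2 -> P2 `<=` P) ->
  P1 `<=` P0.
Proof.
move=> pP0 pP1 pP2 P01 P12 P2x P1x minP2.
have [iP0 _ _] := pP0; have [iP1 _ _] := pP1; have [iP2 _ _] := pP2.
have mE n : @is_submod R R^o (ideal_exp P1 n) := ideal_exp_ideal P1 n.
have m0E n : is_submod (submod_add (P0 : set R^o) (ideal_exp P1 n)).
  exact: submod_addP.
pose F n : set R^o := saturation P1 (submod_add (P0 : set R^o) (ideal_exp P1 n)).
have mF n : is_submod (F n) by exact: saturation_submod.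
have P0F n : P0 `<=` F n.
  by move=> p Pp; apply: sub_saturation => //; exact: (sub_addl (mE n)).
have FS n : F n.+1 `<=` F n.
  move=> r [s Ps [p Pp [q Eq srE]]]; exists s => //; exists p => //; exists q => //.
  exact: ideal_expS.
have [n Fn] := saturated_stabilization pP0 pP2 (subset_trans P01 P12) P2x minP2 mF FS.
have FnS : F n `<=` F n.+1.
  have [g gF] := noeR (mF n).
  suff gFS y : y \in g -> saturation P2 (F n.+1) y.
    move=> r /gF; apply: (spanT_sub (mF _)) => y /gFS [s Ps Fy].
    by apply: saturation_id => //; exists s => // /P12.
  apply: (nakayama pP2 (mF _)) => {}y yg.
  have Fy : F n y by apply/gF/spanT_mem.
  have [s Ps [f Ff [_ [p Pp [_ [b _ <-] <-]] syE]]] := Fn _ Fy.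
  exists s => //; exists (f + p); first by apply: submodD => //; exact: P0F.
  exists (x * b); last by rewrite -syE addrA.
  apply: span_mull => //; apply/gF; apply: saturation_id => //; exists x => //.
  apply: (@submod_addl _ _ _ (f + p) _ (mF n)).
    by apply: (submodD (mF n)); [exact: FS | exact: P0F].
  by rewrite -addrA -[x *: _]/(x * b) syE; exact: submodZ.
have EP0 : ideal_exp P1 n `<=` P0.
  have [g gE] := noeR (mE n).
  have ES : ideal_exp P1 n.+1 `<=` span P1 g.
    apply: ideal_gen_sub; first exact: (span_submod g iP1).
    by move=> _ [u Pu [v /gE gv <-]]; exact: (span_mull iP1 Pu gv).
  suff gP y : y \in g -> saturation P1 (P0 : set R^o) y.
    have satP0 : saturation P1 (P0 : set R^o) `<=` P0.
      move=> v [s Ps /= P0sv]; have [_ _ PM] := pP0.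
      by case: (PM s v P0sv) => // /P01.
    by move=> r /gE; apply: (@spanT_sub _ R^o _ P0) => // y /gP /satP0.
  apply: (@nakayama R R^o _ _ _ pP1 iP0) => {}y yg.
  have /FnS [s Ps [p Pp [q Eq syE]]] : F n y.
    by apply: sub_saturation => //; apply: sub_addr => //; exact/gE/spanT_mem.
  by exists s => //; exists p => //; exists q => //; exact: ES.
move=> y Py; apply: (@primeX _ P0 y n) => //; apply: EP0.
elim: (n) => //= i IH; apply: sub_ideal_gen.
by exists y => //; exists (y ^+ i); rewrite // exprS.
Qed.

Definition prime_chain (Q : nat -> set R) d : Prop :=
  (forall i, (i <= d)%N -> is_prime (Q i)) /\
  forall i, (i < d)%N -> Q i `<=` Q i.+1 /\ ~ Q i.+1 `<=` Q i.

(** Going down the chain, the principal ideal theorem replaces each prime between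
    the two ends by one that contains x; the lowest prime is then dropped. *)
Lemma chain_through (Q : nat -> set R) d x : prime_chain Q d.+1 -> ~ Q 0%N x -> Q d.+1 x ->
  exists Q', [/\ prime_chain Q' d, Q 0%N `<=` Q' 0%N, Q' 0%N x & Q' d `<=` Q d.+1].
Proof.
elim: d Q => [|d IH] Q [pQ sQ] Q0x Qx.
  exists (fun=> Q 1%N); split=> //; last by have [] := sQ 0%N.
  by split=> // i _; exact: pQ.
have [pd pd1 pd2] : [/\ is_prime (Q d), is_prime (Q d.+1) & is_prime (Q d.+2)].
  by split; apply: pQ => //; exact: ltnW.
have [Qd Qd'] := sQ d (leqW (leqnn _)); have [Qd1 Qd1'] := sQ d.+1 (leqnn _).
have [P' [pP' QP' P'x P'Q P'd] P'2] : exists2 P',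
    [/\ is_prime P', Q d `<=` P', P' x, P' `<=` Q d.+2 & ~ P' `<=` Q d]
    & ~ Q d.+2 `<=` P'.
  have [xd1|xd1] := pselect (Q d.+1 x); first by exists (Q d.+1).
  apply: contrapT => noP; apply: Qd'.
  apply: (krull_principal_ideal pd pd1 pd2 Qd Qd1 Qx xd1) => P pP QP Px PQ.
  apply: contrapT => P2; apply: noP; exists P => //; split=> //.
  by move=> /(_ x Px) /Qd.
pose S i := if (i <= d)%N then Q i else P'.
have [|||Q' [[pQ' sQ'] Q0' Q'x Q'd]] := IH S; last 3 first.
- exact: Q0x.
- by rewrite /S ltnn.
- exists (fun i => if (i <= d)%N then Q' i else Q d.+2); split=> //; last by rewrite ltnn.
  split=> i id; first by case: ifP => // /pQ'.
  rewrite ltnS in id; rewrite id; have [lt|] := ltnP i d; first exact: sQ'.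
  move=> di; have -> : i = d by lia.
  rewrite /S ltnn in Q'd; split; first exact: subset_trans P'Q.
  by move=> Q2; apply: P'2; exact: subset_trans Q2 Q'd.
- split=> i id; rewrite /S; first by case: ifP => // id'; apply: pQ; exact: leqW.
  rewrite ltnS in id; rewrite id; have [lt|] := ltnP i d.
    by apply: sQ; rewrite ltnS leqW.
  by move=> di; have -> : i = d by lia.
Qed.

End PrincipalIdeal.

(** * Regular sequences from chains of primes *)

Section RegularSequences.
Variables (R : comNzRingType) (V : lmodType R).
Implicit Types (N B : set V) (xs : seq R).

(** B plus the sum of the x N for x in xs. With N the whole module this is the
    submodule generated by B and xs V, and with B = 0 it is the product of N by
    the ideal generated by xs. *)
Fixpoint add_multiples xs N B : set V :=
  if xs is x :: xs' then [set u + x *: v | u in add_multiples xs' N B & v in N] else B.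

(** The list is read from its end: regular_mod [:: x_d; ...; x_1] N says that
    x_1, ..., x_d is a (weakly) regular sequence on V / N. Truncating the
    sequence is then taking the tail of the list. *)
Fixpoint regular_mod xs N : Prop :=
  if xs is x :: xs' then
    regular_mod xs' N /\
    forall v, add_multiples xs' setT N (x *: v) -> add_multiples xs' setT N v
  else True.

Lemma add_multiples_submod xs N B :
  is_submod N -> is_submod B -> is_submod (add_multiples xs N B).
Proof.
move=> mN mB; elim: xs => //= x xs [IH0 IHD IHZ]; split.
- by exists 0 => //; exists 0; [case: mN | rewrite scaler0 addr0].
- move=> _ _ [u cu [v Nv <-]] [u' cu' [v' Nv' <-]]; exists (u + u'); first exact: IHD.
  by exists (v + v'); [exact: submodD | rewrite scalerDr addrACA].
- move=> c _ [u cu [v Nv <-]]; exists (c *: u); first exact: IHZ.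
  by exists (c *: v); [exact: submodZ | rewrite scalerDr !scalerA mulrC].
Qed.

Lemma add_multiples_mono xs N N' B B' : N `<=` N' -> B `<=` B' ->
  add_multiples xs N B `<=` add_multiples xs N' B'.
Proof.
move=> NN BB; elim: xs => //= x xs IH _ [u cu [v Nv <-]].
by exists u; [exact: IH | exists v => //; exact: NN].
Qed.

Lemma add_multiples_rcons xs x N B :
  add_multiples (rcons xs x) N B = add_multiples xs N (add_multiples [:: x] N B).
Proof. by elim: xs => //= y xs ->. Qed.

Lemma add_multiples_split xs N B v :
  add_multiples xs N B v <-> exists2 u, add_multiples xs N [set 0] u & B (v - u).
Proof.
elim: xs v => [|x xs IH] v /=.
  by split=> [Bv|[_ ->]]; [exists 0 => //; rewrite subr0 | rewrite subr0].
split=> [[w /IH[u cu Bwu] [n Nn <-]]|[_ [u cu [n Nn <-]] Bv]].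
  exists (u + x *: n); first by exists u => //; exists n.
  by rewrite opprD addrACA subrr addr0.
exists (v - x *: n); last by exists n => //; rewrite subrK.
by apply/IH; exists u => //; rewrite -addrA -opprD [x *: n + u]addrC.
Qed.

Lemma add_multiples_in_span (a : set R) xs N g : is_ideal a -> (forall x, x \in xs -> a x) ->
  (forall v, N v -> span setT g v) -> add_multiples xs N [set 0] `<=` span a g.
Proof.
move=> aI xa Ng; have mS := span_submod g aI.
elim: xs xa => [|x xs IH] xa /=; first by move=> _ ->; case: mS.
move=> _ [u cu [v Nv <-]]; apply: submodD => //.
  by apply: IH => // y yx; apply: xa; rewrite inE yx orbT.
by apply: span_mull => //; [apply: xa; exact: mem_head | exact: Ng].
Qed.

Lemma regular_mod_rcons xs x N :
  regular_mod (rcons xs x) N <->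
  regular_mod xs (add_multiples [:: x] setT N) /\ forall v, N (x *: v) -> N v.
Proof.
elim: xs => [|y xs IH]; first by split=> -[].
rewrite /= IH add_multiples_rcons; tauto.
Qed.

(** Vanishing of Tor_1 between V / N and the quotient of R by the ideal of xs. In
    an element u + x v of N, with u a combination of the later elements of the
    list, regularity puts v in N up to such a combination w; then x v is the sum
    of x w and of an element of x N. *)
Theorem regular_mod_tor xs N : is_submod N -> regular_mod xs N ->
  N `&` add_multiples xs setT [set 0] `<=` add_multiples xs N [set 0].
Proof.
move=> mN; elim: xs => [|x xs IH] /= => [_ _ []//|[rN rx] p [Np [u cu [v _ pE]]]].
have m0 := add_multiples_submod xs (@submodT R V) (@submod0 R V).
have [w cw Nvw] : exists2 w, add_multiples xs setT [set 0] w & N (v - w).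
  apply/add_multiples_split/rx; apply/add_multiples_split; exists (- u); first exact: submodN.
  by rewrite opprK addrC pE.
exists (u + x *: w); last first.
  by exists (v - w) => //; rewrite -addrA -scalerDr [w + _]addrC subrK.
apply: (IH rN); split; last by apply: submodD => //; exact: submodZ.
have -> : u + x *: w = p - x *: (v - w).
  by rewrite -pE scalerBr opprB addrACA subrr addr0 addrC.
by apply: submodB => //; exact: submodZ.
Qed.

End RegularSequences.

Section RegularLocal.
Variables (R : comNzRingType) (m : set R).
Hypotheses (noeR : noetherian_ring R) (lm : is_local m).

Lemma prime_sub_local P : is_prime P -> P `<=` m.
Proof.
move=> [[_ _ PZ] P1 _] y Py; apply: contrapT; have [_ _ mU] := lm.
by move=> /mU[z zy]; apply: P1; rewrite -zy; exact: PZ.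
Qed.

(** Generators of m modulo the ideal a form a regular sequence modulo a when
    a chain of d + 1 primes lies above a, d being the number of generators. Stating
    this modulo an arbitrary ideal lets the induction on d pass to P_0 + (x)
    without quotient rings. That P_0 lies in a is part of the induction: it
    rules out that x lies in P_0, and it turns regularity modulo P_0 into
    regularity modulo a. *)
Theorem chain_regular d (xs : seq R) (a : set R) (Q : nat -> set R) :
  size xs = d -> (forall x, x \in xs -> m x) -> is_ideal a ->
  m `<=` @add_multiples R R^o xs setT a -> prime_chain Q d -> a `<=` Q 0%N ->
  Q 0%N `<=` a /\ @regular_mod R R^o xs a.
Proof.
elim: d xs a Q => [|d IH] xs a Q.
  move/eqP/nilP => -> _ _ ma [pQ _] _; split=> //.
  by apply: subset_trans ma; apply: prime_sub_local; exact: pQ.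
case/lastP: xs => // xs x; rewrite size_rcons => -[sxs] mxs aI ma [pQ sQ] aQ.
have mx : m x by apply: mxs; rewrite mem_rcons mem_head.
have {}mxs y : y \in xs -> m y by move=> yx; apply: mxs; rewrite mem_rcons inE yx orbT.
have pQ0 := pQ 0%N isT; have [iQ0 _ MQ0] := pQ0.
have mQ0 : @is_submod R R^o (Q 0%N) := iQ0.
have mT := @submodT R R^o.
rewrite add_multiples_rcons in ma.
have ma0 : m `<=` add_multiples xs setT (add_multiples [:: x] setT (Q 0%N : set R^o)).
  apply: subset_trans ma _; apply: (@add_multiples_mono R R^o) => //.
  exact: (@add_multiples_mono R R^o [:: x]).
(* If x lies in Q 0, the induction hypothesis for the shifted chain gives
   Q 1 = Q 0, which is absurd. *)
have [Qx|Qx] := pselect (Q 0%N x).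
  have [] := IH xs (Q 0%N) (fun i => Q i.+1) => //.
  - apply: subset_trans ma0 _; apply: (@add_multiples_mono R R^o) => // _ [u Qu [v _ <-]].
    apply: (submodD mQ0) => //; rewrite -[x *: v]/(x * v) mulrC; exact: (submodZ v mQ0).
  - by split=> i id; [exact: pQ | exact: sQ].
  - by have [] := sQ 0%N.
  - by have [_ ns] := sQ 0%N isT; move=> /ns.
(* Enlarging the last prime to m makes sure that x lies in it. *)
pose S i := if (i <= d)%N then Q i else m.
have [|||Q' [cQ' QQ' Q'x _]] := @chain_through R noeR S d x.
- split=> i id; rewrite /S; first by case: ifP => [/leqW|_]; [exact: pQ | exact: local_prime].
  rewrite ltnS in id; rewrite id; have [lt|di] := ltnP i d; first exact/sQ/ltnW.
  have -> : i = d by lia.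
  have pd : is_prime (Q d) by apply: pQ.
  split; first exact: prime_sub_local.
  have [s1 s2] := sQ d (leqnn _) => md; apply: s2; apply: subset_trans md.
  by apply: prime_sub_local; exact: pQ.
- exact: Qx.
- by rewrite /S ltnn.
have mc : is_submod (add_multiples [:: x] setT (Q 0%N : set R^o)).
  exact: add_multiples_submod.
have [//|//|//|//|//||_ rQ] := IH xs (add_multiples [:: x] setT (Q 0%N : set R^o)) Q'.
  have [[iQ' _ _] _] : is_prime (Q' 0%N) /\ True by split=> //; apply: cQ'.1.
  move=> _ [u /QQ' Qu [v _ <-]]; apply: (@submodD _ R^o _ _ _ iQ') => //.
  by rewrite -[x *: v]/(x * v) mulrC; exact: (@submodZ _ R^o _ v _ iQ').
have rQ0 : @regular_mod R R^o (rcons xs x) (Q 0%N).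
  by apply/regular_mod_rcons; split=> // v; rewrite -[x *: v]/(x * v) => /MQ0[].
(* Elements of Q 0 lie in a up to multiples of the generators, and these
   multiples can be taken in m (Q 0) by the Tor vanishing. *)
have QA : Q 0%N `<=` a.
  have [g gQ] := noeR mQ0.
  apply: (@nakayama_local R R^o m a (Q 0%N) g lm aI gQ) => p Qp.
  have /ma := prime_sub_local pQ0 Qp.
  rewrite -add_multiples_rcons => /add_multiples_split[w cw apw].
  exists (p - w) => //; exists w; last by rewrite subrK.
  apply: (@add_multiples_in_span R R^o m (rcons xs x) (Q 0%N)).
  - by case: lm.
  - by move=> y; rewrite mem_rcons inE => /predU1P[->|/mxs].
  - by move=> v /gQ.
  apply: (@regular_mod_tor R R^o _ _ mQ0 rQ0); split=> //=.
  by rewrite -[w](subKr p); apply: (submodB mQ0) => //; exact: aQ.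
have aE : a = Q 0%N by apply/seteqP; split.
by split; rewrite ?aE.
Qed.

End RegularLocal.

(** * Minimal resolutions and the main theorem *)

Section FreeModules.
Variable R : comNzRingType.

Lemma add_multiples_rVP (xs : seq R) r (v : 'rV[R]_r) :
  add_multiples xs setT [set 0] v <-> forall j, @add_multiples R R^o xs setT [set 0] (v 0 j).
Proof.
elim: xs v => [|x xs IH] v /=.
  by split=> [-> j|v0]; [rewrite mxE | apply/rowP => j; rewrite v0 mxE].
split=> [[u /IH cu [w _ <-]] j|h].
  by exists (u 0 j); [exact: cu | exists (w 0 j); rewrite // !mxE].
have /choice[w wP] j : exists w : R, @add_multiples R R^o xs setT [set 0] (v 0 j - x * w).
  by have [u cu [w _ <-]] := h j; exists w; rewrite addrK.
exists (v - x *: \row_j w j); last by exists (\row_j w j); rewrite // subrK.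
by apply/IH => j; rewrite !mxE; exact: wP.
Qed.

Lemma regular_mod_rV (xs : seq R) r :
  @regular_mod R R^o xs [set 0] -> @regular_mod R 'rV[R]_r xs [set 0].
Proof.
elim: xs => //= x xs IH [/IH rxs rx]; split=> // v /add_multiples_rVP cv.
by apply/add_multiples_rVP => j; apply: rx; have := cv j; rewrite mxE.
Qed.

Lemma add_multiples_mulmx (xs : seq R) l r (G : 'M[R]_(l, r)) (N B : set 'rV_l) v :
  add_multiples xs N B v -> add_multiples xs (mulmxr G @` N) (mulmxr G @` B) (v *m G).
Proof.
elim: xs v => [|x xs IH] v /=; first by exists v.
move=> [u /IH cu [w Nw <-]]; exists (u *m G) => //; exists (w *m G); first by exists w.
by rewrite mulmxDl scalemxAl.
Qed.

Lemma add_multiples_image (xs : seq R) l r (G : 'M[R]_(l, r)) v :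
  add_multiples xs (row_image G) [set 0] v ->
  exists2 w, add_multiples xs setT [set 0] w & w *m G = v.
Proof.
elim: xs v => [|x xs IH] v /=; first by move=> ->; exists 0; rewrite ?mul0mx.
move=> [u /IH[w cw <-] [_ [t _ <-] <-]]; exists (w + x *: t).
  by exists w => //; exists t.
by rewrite mulmxDl scalemxAl.
Qed.

(** The depth of the syzygy module exceeds that of the module by one: if x v is a
    combination of the later elements of the list modulo ker G, then v G is such
    a combination, since x is regular on the free module modulo them; by the Tor vanishing for
    im G it is the image under G of such a combination, from which v differs by
    an element of ker G. *)
Theorem regular_mod_syzygy (xs : seq R) l r (G : 'M[R]_(l, r)) :
  @regular_mod R R^o xs [set 0] -> regular_mod (behead xs) (row_image G) ->
  regular_mod xs (row_kernel G).
Proof.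
elim: xs => //= x xs IH rR rG; split.
  by apply: IH; [case: rR | case: (xs) rG => //= ? ? []].
have [_ rl] : @regular_mod R 'rV[R]_r (x :: xs) [set 0] by exact: regular_mod_rV.
move=> v /(add_multiples_mulmx G) cv.
have {}cv : add_multiples xs setT [set 0] (v *m G).
  apply: rl; move: cv; rewrite -scalemxAl; apply: add_multiples_mono => // _ [w kw <-].
  exact: kw.
have : add_multiples xs (row_image G) [set 0] (v *m G).
  by apply: (regular_mod_tor (row_image_submod G) rG); split=> //; exists v.
move=> /add_multiples_image[w cw wG]; apply/add_multiples_split; exists w => //.
by rewrite /row_kernel /= mulmxBl wG subrr.
Qed.

Lemma spanT_rows r (g : seq 'rV[R]_r) :
  exists l (G : 'M[R]_(l, r)), span setT g = row_image G.
Proof.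
elim: g => [|x g [l [G gE]]].
  exists 0%N, 0; apply/seteqP; split=> [_ ->|_ [w _ <-]] /=; last by rewrite mulmx0.
  by exists 0; rewrite //= mul0mx.
exists (1 + l)%N, (col_mx x G); apply/seteqP; split=> [_ [c _ [u gu <-]]|_ [w _ <-]].
  have [w _ <-] : row_image G u by rewrite -gE.
  exists (row_mx c%:M w) => //=.
  by rewrite mul_row_col mul_scalar_mx.
rewrite /= -[w]hsubmxK mul_row_col; exists (lsubmx w 0 0) => //.
exists (rsubmx w *m G); first by rewrite gE; exists (rsubmx w).
by rewrite -mul_scalar_mx -mx11_scalar.
Qed.

End FreeModules.

Section MinimalResolution.
Variables (R : comNzRingType) (m : set R).
Hypotheses (noeR : noetherian_ring R) (lm : is_local m).

Definition minimal l r (G : 'M[R]_(l, r)) : Prop :=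
  forall v, row_kernel G v -> forall j, m (v 0 j).

(** A relation with a coefficient outside m, which is a unit, expresses one
    generator through the others, so a generating family of least size has all
    its relations in m. *)
Lemma minimal_generators r (N : set 'rV[R]_r) : is_submod N ->
  exists l (G : 'M[R]_(l, r)), N = row_image G /\ minimal G.
Proof.
move=> mN; have [g gN] := noetherian_rV noeR mN.
have ex : exists l, `[< exists G : 'M[R]_(l, r), N = row_image G >].
  have [l [G gE]] := spanT_rows g; exists l; apply/asboolP; exists G.
  by rewrite -gE; apply/seteqP; split=> v /gN.
case: (ex_minnP ex) => l /asboolP[G NG] lmin; exists l, G; split=> // v vG j.
apply: contrapT => /(let: And3 _ _ mU := lm in mU _)[y yv].
case: l => [|l] in G NG lmin v vG j yv *; first by case: j yv.
suff : (l.+1 <= l)%N by rewrite ltnn.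
apply/lmin/asboolP; exists (row' j G).
have rowj : row j G = - \sum_k (y * v 0 (lift j k)) *: row k (row' j G).
  apply/eqP; rewrite -addr_eq0 -[row j G]scale1r -yv.
  under eq_bigr => k _ do rewrite -scalerA.
  rewrite -scaler_sumr -scalerA -scalerDr; apply/eqP.
  suff -> : v 0 j *: row j G + \sum_k v 0 (lift j k) *: row k (row' j G) = v *m G.
    by rewrite vG scaler0.
  rewrite mulmx_sum_row (bigD1_ord j) //=; congr (_ + _); apply: eq_bigr => k _.
  by congr (_ *: _); apply/rowP => i; rewrite !mxE.
have mS := row_image_submod (row' j G).
have rowS k : row_image (row' j G) (row k (row' j G)).
  by exists (delta_mx 0 k) => //=; rewrite -rowE.
rewrite NG; apply/seteqP; split=> [_ [w _ <-]|_ [w _ <-]] /=.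
  rewrite mulmx_sum_row (bigD1_ord j) //=; apply: submodD => //.
    apply: submodZ => //; rewrite rowj; apply: submodN => //.
    elim/big_ind: _ => [||k _]; last exact: submodZ.
      by case: mS.
    by move=> *; exact: submodD.
  elim/big_ind: _ => [||k _]; [by case: mS | by move=> *; exact: submodD |].
  apply: submodZ => //; have -> // : row (lift j k) G = row k (row' j G).
  by apply/rowP => i; rewrite !mxE.
exists (\row_k (if unlift j k is Some i then w 0 i else 0)) => //=.
rewrite !mulmx_sum_row (bigD1_ord j) //= mxE unlift_none scale0r add0r.
apply: eq_bigr => k _; rewrite mxE liftK; congr (_ *: _).
by apply/rowP => i; rewrite !mxE.
Qed.

Lemma minimal_empty l r (G : 'M[R]_(l, r)) : minimal G -> row_image G `<=` [set 0] -> l = 0%N.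
Proof.
case: l => // l in G * => minG G0; have [_ m1 _] := lm; case: m1.
have := minG (delta_mx 0 0) _ 0; rewrite mxE !eqxx; apply.
by apply: G0; exists (delta_mx 0 0).
Qed.

(** The kernel of G lies in m times the free module by minimality, hence in m
    times itself by the Tor vanishing, and Nakayama applies. *)
Lemma minimal_kernel_eq0 (xs : seq R) l r (G : 'M[R]_(l, r)) : minimal G ->
  (forall x, x \in xs -> m x) -> m `<=` @add_multiples R R^o xs setT [set 0] ->
  regular_mod xs (row_kernel G) -> row_kernel G `<=` [set 0].
Proof.
move=> minG xsm mxs rG; have mK := row_kernel_submod G.
have [g gK] := noetherian_rV noeR mK.
apply: (nakayama_local lm (@submod0 R _) gK) => v Kv.
apply: sub_addr; first exact: submod0.
have [mI _ _] := lm; apply: (add_multiples_in_span mI xsm (N := row_kernel G)) => [u /gK//|].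
apply: regular_mod_tor => //; split=> //; apply/add_multiples_rVP => j.
exact/mxs/minG.
Qed.

Theorem minimal_resolution (I : set R) : is_ideal I ->
  exists (r : nat -> nat) (D : forall i, 'M[R]_(r i.+1, r i)),
    [/\ is_free_resolution I r D, forall i, minimal (D i)
      & forall i, row_kernel (D i) = row_image (D i.+1)].
Proof.
move=> idI.
have mI : @is_submod R 'rV[R]_1 [set v | I (v 0 0)].
  have [I0 ID IM] := idI; split=> [|u v Iu Iv|c u Iu] /=; rewrite mxE //.
    exact: ID.
  exact: IM.
have [l [G [IG minG]]] := minimal_generators mI.
pose T := {r0 : nat & {r1 : nat & 'M[R]_(r1, r0)}}.
pose ex (s : T) := cid (minimal_generators (row_kernel_submod (projT2 (projT2 s)))).
(* The source rank of a stage is the target rank of the next one by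
   computation, so that D below is well typed without casts. *)
pose next (s : T) : T := existT _ (projT1 (projT2 s))
  (existT _ (projT1 (ex s)) (projT1 (cid (projT2 (ex s))))).
pose st i : T := iter i next (existT _ 1%N (existT _ l G)).
pose r i := projT1 (st i).
pose D i : 'M[R]_(r i.+1, r i) := projT2 (projT2 (st i)).
have Dnext i : row_kernel (D i) = row_image (D i.+1) /\ minimal (D i.+1).
  by rewrite /D /=; exact: (projT2 (cid (projT2 (ex (st i))))).
exists r, D; split.
- split=> // [x|i v].
    have := congr1 (fun N => N (const_mx x)) IG; rewrite /= mxE => ->.
    by split=> [[v _ vE]|[v vE]]; exists v.
  have := congr1 (fun N => N v) (Dnext i).1; rewrite /row_kernel /= => ->.
  by split=> [[w _ wE]|[w wE]]; exists w.
- by case=> [|i]; [exact: minG | exact: (Dnext i).2].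
- by move=> i; exact: (Dnext i).1.
Qed.

(** The i-th syzygy module is regular for the first i elements of the sequence,
    starting from the empty sequence for R / I, so from step d on the minimal
    generators of the syzygies have no relations. *)
Theorem regular_finite_resolution (xs : seq R) (I : set R) :
  (forall x, x \in xs -> m x) -> m `<=` @add_multiples R R^o xs setT [set 0] ->
  @regular_mod R R^o xs [set 0] -> is_ideal I ->
  exists (r : nat -> nat) (D : forall i, 'M[R]_(r i.+1, r i)),
    is_free_resolution I r D /\ exists N, forall i, (N < i)%N -> r i = 0%N.
Proof.
move=> xsm mxs rxs /minimal_resolution[r [D [resD minD kerD]]].
exists r, D; split=> //; exists (size xs).+1.
(* The first i elements of the sequence are the last i of the list. *)
have reg i : regular_mod (drop (size xs - i) xs) (row_image (D i)).
  elim: i => [|i IH]; first by rewrite subn0 drop_size.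
  rewrite -kerD; apply: regular_mod_syzygy.
    elim: (xs) (size xs - i.+1)%N rxs => [|x s IHs] [|n] //= [rs _]; exact: IHs.
  rewrite -drop1 drop_drop; have [lt|ge] := ltnP i (size xs).
    by have -> : (1 + (size xs - i.+1) = size xs - i)%N by lia.
  have -> : (size xs - i.+1 = 0)%N by lia.
  move: IH; have -> : (size xs - i = 0)%N by lia.
  by rewrite drop0 addn0 drop1; case: (xs) => //= ? ? [].
case=> // -[//|i]; rewrite !ltnS => xsi.
apply: (minimal_empty (minD i.+1)); rewrite -kerD.
apply: (minimal_kernel_eq0 (minD i) xsm mxs).
by have := reg i.+1; rewrite -kerD (_ : _ - _ = 0)%N ?drop0 //; lia.
Qed.

End MinimalResolution.

Theorem regular_local_finite_resolution (R : comNzRingType) (a : idealr R) (I : set R) :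
  noetherian_ring R -> is_local [set` a] -> is_regular_local a -> is_ideal I ->
  exists (r : nat -> nat) (D : forall i, 'M[R]_(r i.+1, r i)),
    is_free_resolution I r D /\ exists N, forall i, (N < i)%N -> r i = 0%N.
Proof.
move=> noeR la [d [[P Pchain] _] [[x aE] _]].
have aI := idealr_is_ideal a.
pose xs := [seq x i | i : 'I_d].
have xsa y : y \in xs -> [set` a] y.
  by move=> /mapP[i _ ->]; rewrite aE; apply: sub_ideal_gen; exists i.
have axs : [set` a] `<=` @add_multiples R R^o xs setT [set 0].
  rewrite aE; apply: ideal_gen_sub.
    exact: (@add_multiples_submod R R^o xs _ _ (@submodT R R^o) (@submod0 R R^o)).
  move=> _ [i _ <-]; have : x i \in xs by apply: map_f; rewrite mem_enum.
  have m0 s := @add_multiples_submod R R^o s _ _ (@submodT R R^o) (@submod0 R R^o).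
  elim: xs {xsa} => //= y s IH; rewrite inE => /predU1P[<-|/IH cx].
    exists 0; first by case: (m0 s).
    by exists 1 => //; rewrite add0r -[LHS]/(x i * 1) mulr1.
  by exists (x i) => //; exists 0; rewrite // scaler0 addr0.
pose Q i : set R := [set` P (inord i)].
have chQ : prime_chain Q d.
  split=> i id.
    split; first exact: idealr_is_ideal.
      by rewrite /Q /= idealr1.
    by move=> y z; rewrite /Q /= prime_idealrM => /orP.
  have lt : ((inord i : 'I_d.+1) < (inord i.+1 : 'I_d.+1))%N.
    by rewrite !inordK // ltnS ltnW.
  by have [sP nP] := Pchain _ _ lt; split=> [y /sP//|h]; apply: nP => y /h.
have Q0 : [set 0] `<=` Q 0%N by move=> _ ->; rewrite /Q /= rpred0.
have szs : size xs = d by rewrite size_image card_ord.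
have [_ rxs] := chain_regular noeR la szs xsa (@submod0 R R^o) axs chQ Q0.
exact: (regular_finite_resolution noeR la xsa axs rxs).
Qed.

Theorem corollary14 (k : fieldType) (n : nat)
    (H J : prime_idealr {mpoly k[n]}) (HJ : {subset H <= J})
    (L := quot_ideal HJ : prime_idealr {ideal_quot H})
    (AL := localization L : comNzRingType)
    (a := loc_max_ideal L : idealr AL)
    (I : set AL) (idI : is_ideal I) :
  (forall (s : nat -> seq int)
      (C : forall i, 'M[assoc_graded a]_(size (s i.+1), size (s i))),
    is_graded_resolution a (init_ideal a I) s C ->
    exists2 D : forall i, 'M[AL]_(size (s i.+1), size (s i)),
      is_filtered_resolution a I s D &
      forall i j, is_init_form a (row j (D i)) (row j (C i))) /\
  (is_regular_local a ->
    exists (r : nat -> nat) (D : forall i, 'M[AL]_(r i.+1, r i)),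
      is_free_resolution I r D /\
      exists N, forall i, (N < i)%N -> r i = 0%N).
Proof.
have noeR : noetherian_ring AL.
  by apply: noetherian_localization; apply: noetherian_quot; exact: noetherian_mpoly.
have la : is_local [set` a].
  split; first exact: idealr_is_ideal.
    by rewrite /= idealr1.
  by move=> x /= /negP; exact: localization_unit.
split=> [s C resC|reg].
  exact: lift_graded_resolution resC.
exact: (regular_local_finite_resolution noeR la reg idI).
Qed.
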